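(* Let $a=0$, so that the dispersive function is $\omega(\xi)=|\xi|\xi$. The bilinear estimate $$\|\partial_x(u_1u_2)\|_{X^{-1/2}_{1/2}}\le C\|u_1\|_{X^{1/2}_{1/2}}\Big(\|u_2\|_{X^{1/2}_{1/2}}+\|u_2\|_{X^{1/2}_{1/2}}^{1/2}\|u_2\|_{Y^{1/2}_{-1/2,1/2}}^{1/2}\Big)+C\|u_2\|_{X^{1/2}_{1/2}}\Big(\|u_1\|_{X^{1/2}_{1/2}}+\|u_1\|_{X^{1/2}_{1/2}}^{1/2}\|u_1\|_{Y^{1/2}_{-1/2,1/2}}^{1/2}\Big)$$ fails to hold; that is, there is no constant $C$ for which it holds for all $u_1,u_2\in X^{1/2}_{1/2}\cap Y^{1/2}_{-1/2,1/2}$.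
   Context: Functions are of $(x,t)\in\mathbb R^2$. The space-time Fourier transform is $\hat f(\lambda,\xi)=\int\int e^{ix\xi-it\lambda}f(x,t)\,dx\,dt$. Cutoffs: $\chi_0$ is an even smooth characteristic function of $[-1,1]$ and $\chi$ an even smooth characteristic function of $\{1/2<|z|<2\}$ (i.e. even smooth functions with values in $[0,1]$, equal to $1$ on the given set and supported in, respectively, $[-2,2]$ and $\{1/4\le|z|\le4\}$); $\chi_j(z)=\chi(2^{-j}z)$ for integers $j\ge1$. For $s,b\in\mathbb R$, and with $\omega(\xi)=|\xi|\xi$, $X^b_s$ is the closure of the Schwartz functions on $\mathbb R^2$ under $$\|f\|_{X^b_s}=\sum_{j\ge0}2^{jb}\Big(\int_{\mathbb R^2}\chi_j(\lambda-\omega(\xi))(1+|\xi|)^{2s}|\hat f(\lambda,\xi)|^2\,d\xi\,d\lambda\Big)^{1/2}.$$ $Y^b_{s_0,s_1}=\{f: xf\in X^b_{s_0},\ tf\in X^b_{s_1}\}$ with norm $\|xf\|_{X^b_{s_0}}+\|tf\|_{X^b_{s_1}}$. *)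

(* Defs.v *)
From HB Require Import structures.
From mathcomp Require Import all_boot all_order all_algebra.
From mathcomp Require Import all_classical all_reals all_analysis.
From mathcomp Require Import complex.
Set Implicit Arguments.
Unset Strict Implicit.
Unset Printing Implicit Defensive.
Import Order.TTheory GRing.Theory Num.Theory.
Import numFieldTopology.Exports numFieldNormedType.Exports.
Local Open Scope classical_set_scope.
Local Open Scope ring_scope.
Local Open Scope complex_scope.

(* Points of physical space are pairs z = (x, t); points of frequency space
   are pairs y = (lambda, xi), in this order. *)

Definition cmod (R : realType) (w : R[i]) : R := ComplexField.Normc.normc w.

Notation leb2 R := ((@lebesgue_measure R) \x (@lebesgue_measure R))%E.

(* Only meaningful if both components are integrable. *)
Definition cintegral (R : realType) (f : R * R -> R[i]) : R[i] :=
  Rintegral (leb2 R) setT (fun z => complex.Re (f z)) +i*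
  Rintegral (leb2 R) setT (fun z => complex.Im (f z)).

Definition cintegrable (R : realType) (f : R * R -> R[i]) : Prop :=
  (leb2 R).-integrable setT (fun z => (complex.Re (f z))%:E) /\
  (leb2 R).-integrable setT (fun z => (complex.Im (f z))%:E).

Definition cmeasurable (R : realType) (f : R * R -> R[i]) : Prop :=
  measurable_fun setT (fun z => complex.Re (f z)) /\
  measurable_fun setT (fun z => complex.Im (f z)).

Definition cexpi (R : realType) (a : R) : R[i] := cos a +i* sin a.

Definition fourier (R : realType) (f : R * R -> R[i]) (y : R * R) : R[i] :=
  cintegral (fun z => cexpi (z.1 * y.2 - z.2 * y.1) * f z).

Definition pderiv (R : realType) (time : bool) (f : R * R -> R) : R * R -> R :=
  fun z => if time then 'D_(0, 1) f z else 'D_(1, 0) f z.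

Definition iter_pderiv (R : realType) (w : seq bool) (f : R * R -> R) :
  R * R -> R := foldr (@pderiv R) f w.

Definition schwartz_real (R : realType) (f : R * R -> R) : Prop :=
  forall w : seq bool,
    (forall z, differentiable (iter_pderiv w f) z) /\
    (forall k l : nat, exists M : R, forall z : R * R,
       `|z.1| ^+ k * `|z.2| ^+ l * `|iter_pderiv w f z| <= M).

Definition schwartz (R : realType) (f : R * R -> R[i]) : Prop :=
  schwartz_real (fun z => complex.Re (f z)) /\
  schwartz_real (fun z => complex.Im (f z)).

Definition smooth (R : realType) (f : R -> R) : Prop :=
  forall (n : nat) (z : R), derivable (derive1n n f) z 1.

Definition even_cutoff (R : realType) (f : R -> R) : Prop :=
  [/\ smooth f, forall z, f (- z) = f z & forall z, 0 <= f z <= 1].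

Definition is_chi0 (R : realType) (chi0 : R -> R) : Prop :=
  [/\ even_cutoff chi0,
      forall z, `|z| <= 1 -> chi0 z = 1 &
      forall z, 2 < `|z| -> chi0 z = 0].

Definition is_chi (R : realType) (chi : R -> R) : Prop :=
  [/\ even_cutoff chi,
      forall z, 2^-1 < `|z| < 2 -> chi z = 1 &
      forall z, ~~ (4^-1 <= `|z| <= 4) -> chi z = 0].

Definition chi_ (R : realType) (chi0 chi : R -> R) (j : nat) (z : R) : R :=
  if j is 0%N then chi0 z else chi (2 ^- j * z).

Definition omega (R : realType) (xi : R) : R := `|xi| * xi.

Definition schwartz_Xnorm (R : realType) (chi0 chi : R -> R) (b s : R)
    (f : R * R -> R[i]) : \bar R :=
  (\sum_(0 <= j <oo) (2 `^ (j%:R * b))%:E *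
     sqrte (\int[leb2 R]_y
       (chi_ chi0 chi j (y.1 - omega y.2) * (1 + `|y.2|) `^ (2 * s) *
        cmod (fourier f y) ^+ 2)%:E))%E.

(* The completion of the Schwartz functions is realised inside the tempered
   distributions.  A distribution is represented by a functional of which only
   the values on Schwartz functions are used; for the members of X below,
   linearity and continuity there are automatic, since these functionals are
   pointwise limits of Schwartz functions. *)
Definition distribution (R : realType) := (R * R -> R[i]) -> R[i].

Definition dist_of (R : realType) (u : R * R -> R[i]) : distribution R :=
  fun phi => cintegral (fun z => u z * phi z).

(* The functions u for which [dist_of u] makes sense. *)
Definition tempered_fun (R : realType) (u : R * R -> R[i]) : Prop :=
  cmeasurable u /\
  forall phi, schwartz phi -> cintegrable (fun z => u z * phi z).

Definition dist_mulx (R : realType) (T : distribution R) : distribution R :=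
  fun phi => T (fun z => (z.1)%:C * phi z).

Definition dist_mult (R : realType) (T : distribution R) : distribution R :=
  fun phi => T (fun z => (z.2)%:C * phi z).

Definition dist_dx (R : realType) (T : distribution R) : distribution R :=
  fun phi => - T (fun z => pderiv false (fun z' => complex.Re (phi z')) z +i*
                           pderiv false (fun z' => complex.Im (phi z')) z).

Definition X_approx (R : realType) (chi0 chi : R -> R) (b s : R)
    (f : nat -> R * R -> R[i]) (T : distribution R) : Prop :=
  [/\ forall n, schwartz (f n),
      forall e : R, 0 < e -> exists N : nat, forall m n : nat,
        (N <= m)%N -> (N <= n)%N ->
        (schwartz_Xnorm chi0 chi b s (fun z => (f m z - f n z)%R) <= e%:E)%E &
      forall phi, schwartz phi ->
        (fun n => cmod (dist_of (f n) phi - T phi)) @ \oo --> (0 : R)].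

Definition X (R : realType) (chi0 chi : R -> R) (b s : R) :
    set (distribution R) :=
  [set T | exists f, X_approx chi0 chi b s f T].

(* The extension by continuity of [schwartz_Xnorm].  The limit does not depend
   on the approximating sequence, so that the infimum is over one value if T
   is in X, and over none if T is not, in which case the norm is +oo. *)
Definition Xnorm (R : realType) (chi0 chi : R -> R) (b s : R)
    (T : distribution R) : \bar R :=
  ereal_inf [set N : \bar R | exists2 f, X_approx chi0 chi b s f T &
    (fun n => schwartz_Xnorm chi0 chi b s (f n)) @ \oo --> N].

Definition Y (R : realType) (chi0 chi : R -> R) (b s0 s1 : R) :
    set (distribution R) :=
  [set T | X chi0 chi b s0 (dist_mulx T) /\ X chi0 chi b s1 (dist_mult T)].

Definition Ynorm (R : realType) (chi0 chi : R -> R) (b s0 s1 : R)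
    (T : distribution R) : \bar R :=
  (Xnorm chi0 chi b s0 (dist_mulx T) + Xnorm chi0 chi b s1 (dist_mult T))%E.

(* Main.v *)
Require Import Defs.
From HB Require Import structures.
From mathcomp Require Import all_boot all_order all_algebra.
From mathcomp Require Import all_classical all_reals all_analysis.
From mathcomp Require Import measurable_realfun complex ring lra.
Import Order.TTheory GRing.Theory Num.Theory.
Import numFieldTopology.Exports numFieldNormedType.Exports.
Local Open Scope classical_set_scope.
Local Open Scope ring_scope.
Local Open Scope complex_scope.

(* Let N = 2^n.  Multiply a Gaussian at frequency 0 by a wave packet u_2 of width 1/N in xi
   about the point (N^2, N) of the curve lambda = omega xi.  The X and Y norms of the first
   factor are O(1) and those of u_2 are O(N), hence the right-hand side is O(N).  The Fourier
   transform of the product is a Gaussian of width 1 about the same point; as omega' ~ N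
   there, it occupies all the modulations 2^k with k <= n, which contribute equally to the
   norm in X^{-1/2}_{1/2}.

   The norm of d_x(u_1 u_2) is bounded from below by duality: it is paired with the function
   phi whose Fourier transform is psi = sum_{k <= n} 2^-k g_k, where g_k is a Gaussian of
   widths 1 in lambda and 2^k / N in xi about (N^2, N).  Each g_k contributes a constant to
   the pairing, whereas the Cauchy-Schwarz inequality bounds the pairing by the norm times
   (int (1 + 4 |lambda - omega xi|) (1 + |xi|)^-1 psi^2)^(1/2) = O(n^(1/2) / N).  So the
   left-hand side is at least c N n^(1/2). *)

(** The left-hand norm is an infimum over approximating sequences, which are tied to the
    distribution only by convergence against Schwartz functions. A pairing with one fixed Schwartz
    function survives that limit, hence the duality. On the right-hand side the packets are
    Schwartz, and constant sequences give the upper bounds.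

    The width 1/N keeps u_2 at modulation O(1), because omega' is of order N. Its transform has
    height N, so its norm in X^{1/2}_{1/2} is of order N N^(-1/2) N^(1/2) = N. Multiplication by x
    costs the length N of the packet, which the change of the weight from N^(1/2) to N^(-1/2) pays
    for exactly.

    The product has a transform of height O(1), and modulation 2^k fills a strip of xi-width 2^k /
    N. There the pairing of d_x(u_1 u_2) with 2^-k g_k has size N 2^-k 2^k / N = 1. Cauchy-Schwarz
    is applied on each modulation shell with the integral of psi^2 over the whole plane, which loses
    n^(1/2) against the sum over the shells; any growth in n suffices. *)

(** * Gaussians on the line *)

Section gauss1.
Context {R : realType}.
Notation mu := (@lebesgue_measure R).

(** It suffices to bound 1 + |p| by D exp(c p^2 / k) and to raise this to the power k; the
    exponential is bounded below by its tangent 1 + c p^2 / k. *)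
Lemma one_plus_abs_expR (k : nat) (c : R) : 0 < c ->
  exists2 C : R, 0 < C & forall p : R, (1 + `|p|) ^+ k <= C * expR (c * p ^+ 2).
Proof.
move=> c0; case: k => [|k].
  by exists 1 => // p; rewrite expr0 mul1r -[leLHS]expR0 ler_expR mulr_ge0 ?sqr_ge0 ?ltW.
have k0 : 0 < k.+1%:R :> R by rewrite ltr0n.
(* From |p| <= 1 + p^2 follows 1 + |p| <= 2 + p^2: the 2 in the maximum covers the constant, the
   quotient covers p^2. *)
pose D := Num.max 2 (k.+1%:R / c).
have D2 : 2 <= D by rewrite le_max lexx.
have Dc : 1 <= D * (c / k.+1%:R).
  have: k.+1%:R / c <= D by rewrite le_max lexx orbT.
  by rewrite ler_pdivrMr// => h; rewrite mulrA ler_pdivlMr// mul1r.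
have D0 : 0 < D by apply: lt_le_trans D2.
exists (D ^+ k.+1) => [|p]; first by rewrite exprn_gt0.
have -> : c * p ^+ 2 = (c / k.+1%:R * p ^+ 2) *+ k.+1.
  by rewrite -mulr_natr mulrAC divfK ?gt_eqF.
rewrite -[c / _ * _ *+ _]mulr_natr expRM_natr -exprMn lerXn2r ?nnegrE ?addr_ge0//.
  by rewrite mulr_ge0 ?expR_ge0// ltW.
apply: (@le_trans _ _ (D * (1 + c / k.+1%:R * p ^+ 2))); last first.
  by rewrite ler_pM2l// expR_ge1Dx.
have -> : p ^+ 2 = `|p| ^+ 2 by rewrite real_normK ?num_real.
rewrite mulrDr mulr1 mulrA.
have : `|p| ^+ 2 <= D * (c / k.+1%:R) * `|p| ^+ 2 by rewrite ler_peMl ?sqr_ge0.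
have : 0 <= (`|p| - 1) ^+ 2 by rewrite sqr_ge0.
set q := `|p|; set e := D * (c / _) => h1 h2.
have h3 : q <= 1 + q ^+ 2 by nra.
have h4 : 1 + q ^+ 2 <= 1 + e * q ^+ 2 by lra.
by lra.
Qed.

Lemma normal_funE (m a x : R) : 0 < a -> normal_fun m a x = expR (- (((x - m) / a) ^+ 2 / 2)).
Proof.
by move=> a0; rewrite /normal_fun; congr expR; rewrite mulNr -mulr_natr; field; rewrite gt_eqF.
Qed.

Lemma normal_fun_integral (m a : R) : 0 < a ->
  (\int[mu]_x (normal_fun m a x)%:E)%E = ((normal_peak a)^-1)%:E.
Proof.
move=> a0; have an0 : a != 0 by rewrite gt_eqF.
have p0 := normal_peak_gt0 an0.
have := integral_normal_pdf m a; rewrite normal_pdfE//=.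
under eq_integral do rewrite EFinM.
rewrite ge0_integralZl//=; last 3 first.
- by apply/measurable_EFinP; exact: measurable_normal_fun.
- by move=> x _; rewrite lee_fin normal_fun_ge0.
- by rewrite lee_fin ltW.
set I := (\int[_]_x _)%E => hI.
have : ((normal_peak a)^-1%:E * ((normal_peak a)%:E * I) = (normal_peak a)^-1%:E)%E.
  by rewrite hI mule1.
by rewrite muleA -EFinM mulVf ?gt_eqF// mul1e.
Qed.

Lemma normal_fun_integrable (m a : R) : 0 < a ->
  mu.-integrable setT (EFin \o normal_fun m a).
Proof.
move=> a0.
apply/integrableP; split; first by apply/measurable_EFinP; exact: measurable_normal_fun.
under eq_integral do rewrite /= ger0_norm ?normal_fun_ge0//.
by rewrite normal_fun_integral// ltry.
Qed.

End gauss1.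

(** A polynomial factor is paid for by doubling the width. The exponent 3/8 = 1/2 - 1/8 is what
    separates [normal_fun m a] from [normal_fun m (2 * a)]. *)
Lemma normal_fun_dominated {R : realType} (m a : R) (f : R -> R) (k : nat) (c : R) :
  0 < a -> measurable_fun setT f ->
  (forall x, `|f x| <= c * (1 + `|(x - m) / a|) ^+ k * normal_fun m a x) ->
  (@lebesgue_measure R).-integrable setT (EFin \o f).
Proof.
move=> a0 mf hf.
have [C C0 hC] := @one_plus_abs_expR R k (3 / 8) ltac:(lra).
have a20 : 0 < 2 * a by lra.
have h2 := normal_fun_integrable m _ a20.
have key (x : R) : `|f x| <= `| `|c| * C * normal_fun m (2 * a) x|; last first.
  have : (@lebesgue_measure R).-integrable setT (fun x => ((`|c| * C)%:E * (normal_fun m (2 * a) x)%:E)%E).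
    by apply: integrableZl.
  apply: le_integrable => //; first exact/measurable_EFinP.
  by move=> x _; rewrite -EFinM lee_fin.
rewrite (le_trans (hf x))//.
have p0 : 0 <= `|c| * C * normal_fun m (2 * a) x.
  by rewrite !mulr_ge0 ?normal_fun_ge0// ltW.
rewrite (ger0_norm p0) -!mulrA.
apply: (@le_trans _ _ (`|c| * ((1 + `|(x - m) / a|) ^+ k * normal_fun m a x))).
  by rewrite ler_wpM2r ?ler_norm// mulr_ge0 ?normal_fun_ge0// exprn_ge0// addr_ge0.
rewrite ler_wpM2l//.
apply: (le_trans (ler_wpM2r (normal_fun_ge0 _ _ _) (hC _))).
rewrite -mulrA ler_pM2l// !normal_funE// -expRD ler_expR.
rewrite le_eqVlt; apply/orP; left; apply/eqP; field; by rewrite gt_eqF.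
Qed.

(** The integrals over growing intervals are boundary terms, which tend to 0; dominated convergence
    under |f| identifies their limit. *)
Lemma integralT_derive0 {R : realType} (F f : R -> R) :
  continuous f -> (forall x : R, is_derive x (1:R) F (f x)) ->
  (@lebesgue_measure R).-integrable setT (EFin \o f) ->
  F x @[x --> +oo] --> 0 -> F x @[x --> -oo] --> 0 ->
  (\int[@lebesgue_measure R]_x (f x)%:E)%E = 0%E.
Proof.
move=> cf dF fi Fp Fn.
(* With [n.+1] the interval is never degenerate, as the fundamental theorem of calculus requires. *)
pose A (n : nat) : set R := `[- n.+1%:R, n.+1%:R]%classic.
have h : (fun n => \int[@lebesgue_measure R]_x (((EFin \o f) \_ (A n)) x))%E @ \oo -->
     (\int[@lebesgue_measure R]_x (f x)%:E)%E.
  refine (@dominated_cvg _ _ R (@lebesgue_measure R) setT measurableT (fun n => (EFin \o f) \_ (A n))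
     (EFin \o f) (fun x => `|(f x)%:E|%E) _ _ _ _ _) => //.
  - move=> n; apply/(measurable_restrictT _ _).1 => //.
      exact: measurable_itv.
    by apply: measurable_funTS; exact: (measurable_int _ fi).
  - move=> x _; apply: cvg_near_cst; exists (`|Num.ceil `|x| |)%N => //= n /= hn.
    have {}hn : `|x : R| <= n.+1%:R.
      apply: (le_trans (ceil_ge _)).
      rewrite -[leRHS]/((n.+1%:Z)%:~R) ler_int (le_trans (ler_norm _))//.
      by rewrite -abszE lez_nat leqW.
    by rewrite patchE mem_set//= /A/= in_itv/= -ler_norml.
  - exact/integrable_abse.
  - move=> n x _; rewrite patchE; case: ifP => _ //=.
    by rewrite lee_fin normr0.
have h0 : (fun n => \int[@lebesgue_measure R]_x (((EFin \o f) \_ (A n)) x))%E @ \oo --> 0%E.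
  have -> : (fun n => \int[@lebesgue_measure R]_x (((EFin \o f) \_ (A n)) x))%E =
      (fun n => (F n.+1%:R - F (- n.+1%:R))%:E).
    apply/funext => n; rewrite -integral_mkcond (@continuous_FTC2 _ _ F)//.
    + by rewrite gtrN// ltr0n.
    + exact: continuous_subspaceT.
    + split.
      * by move=> x _; apply: ex_derive.
      * apply: cvg_at_right_filter; apply: differentiable_continuous.
        by apply/derivable1_diffP; apply: ex_derive.
      * apply: cvg_at_left_filter; apply: differentiable_continuous.
        by apply/derivable1_diffP; apply: ex_derive.
    + by move=> x _; rewrite derive1E derive_val.
  rewrite (_ : 0%E = (0 - 0)%:E); last by rewrite subrr.
  apply: cvg_EFin; first exact: nearW.
  apply: cvgB.
    apply: (cvg_comp _ _ _ Fp).
    by rewrite (cvg_shiftS (fun n => n%:R : R)); exact: cvgr_idn.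
  apply: (cvg_comp _ _ _ Fn).
  apply/cvgNrNy.
  by rewrite (cvg_shiftS (fun n => n%:R : R)); exact: cvgr_idn.
exact: (cvg_unique _ h h0).
Qed.

Lemma continuous_normal_fun {R : realType} (m a : R) : continuous (normal_fun m a).
Proof.
move=> x; apply: (cvg_comp _ (@expR R)); last exact: continuous_expR.
apply: cvgM; last exact: cvg_cst.
apply: (@cvgN _ R^o).
apply: (cvg_comp (fun x => x - m) (fun x => x ^+ 2)).
  by apply: (@cvgB _ R^o) => //; [exact: cvg_id|exact: cvg_cst].
exact: sqr_continuous.
Qed.

Lemma normal_fun_cvg0 {R : realType} (m a : R) : 0 < a ->
  normal_fun m a x @[x --> +oo] --> 0 /\ normal_fun m a x @[x --> -oo] --> 0.
Proof.
move=> a0.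
have H (F : set_system R) : Filter F -> (fun x => ((x - m) / a) ^+ 2) @ F --> +oo ->
    normal_fun m a x @[x --> F] --> 0.
  move=> FF h.
  under eq_fun do rewrite normal_funE//.
  apply: (cvg_comp _ (fun y => expR (- y)) _ (@cvgr_expR R)).
  by apply: gt0_cvgMly => //; rewrite invr_gt0.
split; apply: H.
  apply: (cvg_comp (fun x => (x - m) / a) (fun y => y ^+ 2) _ cvgr_expr2).
  by apply: gt0_cvgMly; [rewrite invr_gt0|exact: cvg_addrr].
under eq_fun do rewrite -sqrrN.
apply: (cvg_comp (fun x => - ((x - m) / a)) (fun y => y ^+ 2) _ cvgr_expr2).
apply/cvgNry.
by apply: gt0_cvgMlNy; [rewrite invr_gt0|exact: cvg_addrr_Ny].
Qed.

Lemma is_derive_normal_fun {R : realType} (m a x : R) : 0 < a ->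
  is_derive x (1:R) (normal_fun m a) (- ((x - m) / a ^+ 2) * normal_fun m a x).
Proof.
move=> a0; rewrite /normal_fun.
have h : is_derive x (1:R) (fun x : R => - (x - m) ^+ 2 / (a ^+ 2 *+ 2)) (- ((x - m) / a ^+ 2)).
  have -> : (fun x : R => - (x - m) ^+ 2 / (a ^+ 2 *+ 2)) =
     (- (a ^+ 2 *+ 2)^-1) \*: ((id - cst m) ^+ 2).
    by apply/funext => y /=; rewrite !fctE /GRing.scale/=; field; rewrite gt_eqF.
  apply: is_derive_eq; rewrite /GRing.scale/= subr0 mulr1 expr1 !fctE.
  by field; rewrite gt_eqF.
have := @is_derive1_comp R expR _ x _ _ (is_derive_expR _) h.
by rewrite mulrC.
Qed.

(** * Fourier integrals of Gaussians in one variable *)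

Section fourier1.
Context {R : realType}.
Notation mu := (@lebesgue_measure R).
Variables (m a th : R).
Hypothesis a0 : 0 < a.
Notation W := (normal_fun m a).
Notation cw xi := (fun x : R => cos ((x - m) * xi + th) * W x).
Notation sw xi := (fun x : R => (x - m) * sin ((x - m) * xi + th) * W x).

Let mphase xi : measurable_fun setT (fun x : R => (x - m) * xi + th).
Proof. by apply: measurable_funD => //; apply: measurable_funM => //; exact: measurable_funB. Qed.

Lemma measurable_cos_normal xi : measurable_fun setT (cw xi).
Proof.
apply: measurable_funM; last exact: measurable_normal_fun.
by apply: measurableT_comp => //; apply: continuous_measurable_fun; exact: continuous_cos.
Qed.

Lemma measurable_sin_normal xi : measurable_fun setT (sw xi).
Proof.
apply: measurable_funM; last exact: measurable_normal_fun.
apply: measurable_funM; first exact: measurable_funB.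
by apply: measurableT_comp => //; apply: continuous_measurable_fun; exact: continuous_sin.
Qed.

Lemma cos_normal_integrable xi : mu.-integrable setT (EFin \o cw xi).
Proof.
apply: (@normal_fun_dominated _ m a _ 0 1 a0 (measurable_cos_normal xi)) => x.
rewrite expr0 !mul1r normrM [X in _ * X]ger0_norm ?normal_fun_ge0//.
by rewrite ler_piMl ?normal_fun_ge0// ler_norml cos_geN1 cos_le1.
Qed.

Let xW_le (x s : R) : `|s| <= 1 ->
  `|(x - m) * s * W x| <= a * (1 + `|(x - m) / a|) ^+ 1 * W x.
Proof.
move=> s1; rewrite normrM [X in _ * X]ger0_norm ?normal_fun_ge0//.
rewrite ler_wpM2r ?normal_fun_ge0// expr1 normrM normf_div (gtr0_norm a0).
apply: (@le_trans _ _ (`|x - m| * 1)); first by rewrite ler_wpM2l.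
by rewrite mulr1 mulrDr mulrCA divff ?gt_eqF// !mulr1 lerDr ltW.
Qed.

Lemma sin_normal_integrable xi : mu.-integrable setT (EFin \o sw xi).
Proof.
apply: (@normal_fun_dominated _ m a _ 1 a a0 (measurable_sin_normal xi)) => x.
by apply: xW_le; rewrite ler_norml sin_geN1 sin_le1.
Qed.

(** Integration by parts: the derivative of sin(phase) W is xi cos(phase) W - a^-2 (x - m)
    sin(phase) W, and its integral vanishes. *)
Lemma Rintegral_sin_normal xi :
  \int[mu]_x (sw xi x) = a ^+ 2 * xi * \int[mu]_x (cw xi x).
Proof.
pose F (x : R) := sin ((x - m) * xi + th) * W x.
pose f (x : R) := xi * cw xi x - (a ^+ 2)^-1 * sw xi x.
have dphase (x : R) : is_derive x (1:R) (fun x : R => (x - m) * xi + th) xi.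
  have -> : (fun x : R => (x - m) * xi + th) = xi \*: (id - cst m) + cst th.
    by apply/funext => y /=; rewrite !fctE /GRing.scale/= mulrC.
  by apply: is_derive_eq; rewrite /GRing.scale/= subr0 mulr1 addr0.
have dF (x : R) : is_derive x (1:R) F (f x).
  have d1 := @is_derive1_comp R (@sin R) _ x _ _ (is_derive_sin _) (dphase x).
  have d2 := @is_derive_normal_fun R m a x a0.
  apply: (is_derive_eq (is_deriveM d1 d2)).
  by rewrite /f /GRing.scale/=; field; rewrite gt_eqF.
have cphase : continuous (fun x : R => (x - m) * xi + th).
  move=> x; apply: differentiable_continuous; apply/derivable1_diffP.
  by have := dphase x; case.
have cf : continuous f.
  move=> x; apply: cvgB; apply: cvgM; first exact: cvg_cst.
  - apply: cvgM; last exact: continuous_normal_fun.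
    by apply: (cvg_comp _ (@cos R) (cphase x)); exact: continuous_cos.
  - exact: cvg_cst.
  - apply: cvgM; last exact: continuous_normal_fun.
    apply: cvgM; first by apply: (@cvgB _ R^o); [exact: cvg_id|exact: cvg_cst].
    by apply: (cvg_comp _ (@sin R) (cphase x)); exact: continuous_sin.
have i1 : mu.-integrable setT (fun x => (xi * cw xi x)%:E).
  under eq_fun do rewrite EFinM.
  by apply: integrableZl => //; exact: cos_normal_integrable.
have i2 : mu.-integrable setT (fun x => ((a ^+ 2)^-1 * sw xi x)%:E).
  under eq_fun do rewrite EFinM.
  by apply: integrableZl => //; exact: sin_normal_integrable.
have fi : mu.-integrable setT (EFin \o f).
  rewrite /f /comp; under eq_fun do rewrite EFinB.
  exact: integrableB.
have [Wp Wn] := normal_fun_cvg0 m _ a0.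
have FW x : `|F x| <= W x.
  rewrite normrM [X in _ * X]ger0_norm ?normal_fun_ge0//.
  by rewrite ler_piMl ?normal_fun_ge0// ler_norml sin_geN1 sin_le1.
have F0 (G : set_system R) : Filter G -> W x @[x --> G] --> 0 -> F x @[x --> G] --> 0.
  move=> FG h; apply/norm_cvg0P.
  apply: (squeeze_cvgr _ (cvg_cst 0) h).
  by apply: nearW => x; rewrite normr_ge0 FW.
have I0 := @integralT_derive0 R F f cf dF fi (F0 _ _ Wp) (F0 _ _ Wn).
have : \int[mu]_x (f x) = 0 by rewrite /Rintegral I0.
rewrite /f RintegralB//.
rewrite RintegralZl//; last exact: cos_normal_integrable.
rewrite RintegralZl//; last exact: sin_normal_integrable.
move/eqP; rewrite subr_eq0 => /eqP h.
by rewrite -mulrA h mulVKf// sqrf_eq0 gt_eqF.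
Qed.

(** As a function g of xi the integral solves g' = - a^2 xi g, by differentiation under the integral
    and [Rintegral_sin_normal]. Hence g(xi) exp((a xi)^2 / 2) is constant, equal to its value at
    0. *)
Lemma Rintegral_cos_normal xi :
  \int[mu]_x (cw xi x) =
  cos th * (normal_peak a)^-1 * expR (- ((a * xi) ^+ 2 / 2)).
Proof.
pose g (xi : R) := \int[mu]_x (cw xi x).
have dphase (x xi0 : R) : is_derive xi0 (1:R) (fun xi : R => (x - m) * xi + th) (x - m).
  have -> : (fun xi : R => (x - m) * xi + th) = (x - m) \*: id + cst th.
    by apply/funext => y /=; rewrite !fctE /GRing.scale/=.
  by apply: is_derive_eq; rewrite /GRing.scale/= mulr1 addr0.
have dcw (x xi0 : R) : is_derive xi0 (1:R) (fun xi => cw xi x) (- sw xi0 x).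
  have d1 := @is_derive1_comp R (@cos R) _ xi0 _ _ (is_derive_cos _) (dphase x xi0).
  apply: (is_derive_eq (is_deriveM d1 (is_derive_cst (W x) xi0 (1:R)))).
  by rewrite /GRing.scale/= mulr0 add0r; ring.
have dg (xi0 : R) : is_derive xi0 (1:R) g (- (a ^+ 2 * xi0 * g xi0)).
  have xi0I : `]xi0 - 1, xi0 + 1[%classic xi0.
    by rewrite /= in_itv/=; apply/andP; split; lra.
  (* This bound of the xi-derivative is uniform in xi, so an arbitrary interval about [xi0]
     serves. *)
  pose G (x : R) := a * (1 + `|(x - m) / a|) ^+ 1 * W x.
  have G0 x : 0 <= G x.
    by rewrite /G !mulr_ge0 ?normal_fun_ge0 ?exprn_ge0 ?addr_ge0// ltW.
  have mG : measurable_fun setT G.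
    apply: measurable_funM; last exact: measurable_normal_fun.
    apply: measurable_funM => //; apply: measurable_funX.
    apply: measurable_funD => //; apply: measurableT_comp => //.
    by apply: measurable_funM => //; exact: measurable_funB.
  have iG : mu.-integrable setT (EFin \o G).
    by apply: (@normal_fun_dominated _ m a _ 1 a a0 mG) => x; rewrite ger0_norm.
  have intf (x : R) : `]xi0 - 1, xi0 + 1[%classic x ->
      mu.-integrable setT (EFin \o (fun y => cw x y)).
    by move=> _; exact: cos_normal_integrable.
  have df (x y : R) : `]xi0 - 1, xi0 + 1[%classic x -> setT y ->
      derivable ((fun xi y => cw xi y) ^~ y) x 1.
    by move=> _ _; have [] := dcw y x.
  have dE (x y : R) : partial1of2 (fun xi y => cw xi y) x y = - sw x y.
    by rewrite partial1of2E; have [_ ->] := dcw y x.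
  have G_ub (x y : R) : `]xi0 - 1, xi0 + 1[%classic x -> setT y ->
     `|partial1of2 (fun xi y => cw xi y) x y| <= G y.
    move=> _ _; rewrite dE normrN; apply: xW_le.
    by rewrite ler_norml sin_geN1 sin_le1.
  have D1 := @derivable_under_integral R _ _ mu _ setT measurableT _ _ _ xi0I intf df G G0 iG G_ub.
  have D2 := @differentiation_under_integral R _ _ mu _ setT measurableT _ _ _ xi0I intf df G G0 iG G_ub.
  split; first exact: D1.
  rewrite -derive1E [LHS]D2 -Rintegral_sin_normal.
  under eq_Rintegral do rewrite dE.
  under eq_Rintegral do rewrite -mulN1r.
  by rewrite RintegralZl ?mulN1r//; exact: sin_normal_integrable.
pose h (xi : R) := g xi * expR ((a * xi) ^+ 2 / 2).
have dh (x : R) : is_derive x (1:R) h 0.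
  have d1 : is_derive x (1:R) (fun xi : R => (a * xi) ^+ 2 / 2) (a ^+ 2 * x).
    have -> : (fun xi : R => (a * xi) ^+ 2 / 2) = (a ^+ 2 / 2) \*: (id ^+ 2).
      by apply/funext => y /=; rewrite !fctE /GRing.scale/=; field.
    by apply: is_derive_eq; rewrite /GRing.scale/= mulr1 expr1; field.
  have d2 := @is_derive1_comp R expR _ x _ _ (is_derive_expR _) d1.
  apply: (is_derive_eq (is_deriveM (dg x) d2)).
  by rewrite /GRing.scale/=; ring.
have := is_derive_0_is_cst xi 0 dh.
rewrite /h mulr0 expr0n mul0r expR0 mulr1 => h0.
have -> : \int[mu]_x (cw xi x) = g xi * expR ((a * xi) ^+ 2 / 2) * expR (- ((a * xi) ^+ 2 / 2)).
  by rewrite -mulrA expRxMexpNx_1 mulr1.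
rewrite h0 /g; congr (_ * _).
under eq_Rintegral do rewrite mulr0 add0r.
rewrite RintegralZl//; last exact: normal_fun_integrable.
by rewrite /Rintegral normal_fun_integral.
Qed.

End fourier1.

(** The integral of a nonnegative function is a supremum over the simple functions below it. This
    makes it monotone on the integrands of the norms, whose Fourier transforms come with pointwise
    bounds only. *)
Lemma ge0_le_integralT {d} {T : measurableType d} {R : realType}
    (mu : {measure set T -> \bar R}) (f g : T -> \bar R) :
  (forall x, 0 <= f x)%E -> (forall x, f x <= g x)%E ->
  (\int[mu]_x f x <= \int[mu]_x g x)%E.
Proof.
move=> f0 fg; rewrite !ge0_integralTE//; last by move=> x; exact: le_trans (fg x).
apply: le_ereal_sup => _ [h /= hf <-]; exists h => //= x.
exact: le_trans (fg x).
Qed.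

Section sin_cos_normal.
Context {R : realType}.
Notation mu := (@lebesgue_measure R).
Variables (m a xi th : R).
Hypothesis a0 : 0 < a.
Notation W := (normal_fun m a).
Notation ph := (fun x : R => (x - m) * xi + th).
Notation se := ((normal_peak a)^-1 * expR (- ((a * xi) ^+ 2 / 2))).

Lemma integral_cosW : mu.-integrable setT (EFin \o (fun x : R => cos (ph x) * W x)) /\
  \int[mu]_x (cos (ph x) * W x) = cos th * se.
Proof.
split; first exact: cos_normal_integrable.
by rewrite Rintegral_cos_normal// mulrA.
Qed.

Lemma integral_xsinW :
  mu.-integrable setT (EFin \o (fun x : R => (x - m) * sin (ph x) * W x)) /\
  \int[mu]_x ((x - m) * sin (ph x) * W x) = a ^+ 2 * xi * cos th * se.
Proof.
split; first exact: sin_normal_integrable.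
by rewrite Rintegral_sin_normal// Rintegral_cos_normal// !mulrA.
Qed.

End sin_cos_normal.

Section sin_cos_normal2.
Context {R : realType}.
Notation mu := (@lebesgue_measure R).
Variables (m a xi th : R).
Hypothesis a0 : 0 < a.
Notation W := (normal_fun m a).
Notation ph := (fun x : R => (x - m) * xi + th).
Notation se := ((normal_peak a)^-1 * expR (- ((a * xi) ^+ 2 / 2))).

(** The cosine formula at the phase [th - pi / 2]; for this [th] had to be generalised in the
    preceding section. *)
Lemma integral_sinW : mu.-integrable setT (EFin \o (fun x : R => sin (ph x) * W x)) /\
  \int[mu]_x (sin (ph x) * W x) = sin th * se.
Proof.
have -> : (fun x : R => sin (ph x) * W x) =
    (fun x : R => cos ((x - m) * xi + (th - pi / 2)) * W x).
  apply/funext => x; rewrite addrA; congr (_ * _).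
  by rewrite cosBpihalf.
have [h1 h2] := @integral_cosW R m a xi (th - pi / 2) a0; split=> //.
by rewrite h2 cosBpihalf.
Qed.

Lemma integral_xcosW :
  mu.-integrable setT (EFin \o (fun x : R => (x - m) * cos (ph x) * W x)) /\
  \int[mu]_x ((x - m) * cos (ph x) * W x) = - (a ^+ 2 * xi * sin th * se).
Proof.
have -> : (fun x : R => (x - m) * cos (ph x) * W x) =
    (fun x : R => (x - m) * sin ((x - m) * xi + (th + pi / 2)) * W x).
  by apply/funext => x; rewrite addrA sinDpihalf.
have [h1 h2] := @integral_xsinW R m a xi (th + pi / 2) a0; split=> //.
by rewrite h2 cosDpihalf mulrN mulNr.
Qed.

End sin_cos_normal2.

(** * Tensor products and Fourier integrals in the plane *)

Lemma integrable_tensor {d1 d2} {T1 : measurableType d1} {T2 : measurableType d2}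
    {R : realType} {m1 : {sigma_finite_measure set T1 -> \bar R}}
    {m2 : {sigma_finite_measure set T2 -> \bar R}} (f : T1 -> R) (g : T2 -> R) :
  m1.-integrable setT (EFin \o f) -> m2.-integrable setT (EFin \o g) ->
  (m1 \x m2)%E.-integrable setT (fun w => (f w.1 * g w.2)%:E).
Proof.
move=> fi gi.
have mf : measurable_fun setT f by apply/measurable_EFinP; exact: (measurable_int _ fi).
have mg : measurable_fun setT g by apply/measurable_EFinP; exact: (measurable_int _ gi).
apply/integrable12ltyP.
  apply/measurable_EFinP; apply: measurable_funM.
    by apply: measurableT_comp => //; exact: measurable_fst.
  by apply: measurableT_comp => //; exact: measurable_snd.
under eq_integral => x _.
  under eq_integral do rewrite /= normrM EFinM.
  rewrite ge0_integralZl//; last by apply/measurable_EFinP; exact: measurableT_comp.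
  over.
have [_ fy] := integrableP _ _ _ fi.
have [_ gy] := integrableP _ _ _ gi.
rewrite ge0_integralZr//.
- by apply: lte_mul_pinfty => //; [exact: integral_ge0|rewrite ge0_fin_numE//; exact: integral_ge0].
- by apply/measurable_EFinP; exact: measurableT_comp.
- exact: integral_ge0.
Qed.

Section tensor.
Context {R : realType}.
Notation mu := (@lebesgue_measure R).
Variables (f g : R -> R).
Hypothesis fi : mu.-integrable setT (EFin \o f).
Hypothesis gi : mu.-integrable setT (EFin \o g).

Lemma Rintegral_tensor : Rintegral (leb2 R) setT (fun z => f z.1 * g z.2) =
  (\int[mu]_x f x) * (\int[mu]_x g x).
Proof.
rewrite /Rintegral -(integral12_prod_meas1 (integrable_tensor _ _ fi gi)) /fubini_F /=.
have gf : (\int[mu]_x (g x)%:E)%E \is a fin_num by exact: integrable_fin_num.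
have ff : (\int[mu]_x (f x)%:E)%E \is a fin_num by exact: integrable_fin_num.
under eq_integral => x _.
  under eq_integral do rewrite EFinM.
  rewrite integralZl//.
  over.
rewrite -(fineK gf) /= integralZr//.
by rewrite -(fineK ff) -EFinM.
Qed.

End tensor.

Section fourier2.
Context {R : realType}.
Notation mu := (@lebesgue_measure R).
Variables (m n a b p q th : R).
Hypothesis (a0 : 0 < a) (b0 : 0 < b).
Notation ph := (fun z : R * R => (z.1 - m) * p + (z.2 - n) * q + th).
Notation WW := (fun z : R * R => normal_fun m a z.1 * normal_fun n b z.2).

Definition gauss_ft : R := (normal_peak a)^-1 * (normal_peak b)^-1 *
  (expR (- ((a * p) ^+ 2 / 2)) * expR (- ((b * q) ^+ 2 / 2))).

(** The cosine of a sum is cos cos - sin sin, a difference of two tensor products. Below, the first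
    variable always gets the phase 0 and the second the whole of [th]. *)
Let add_tensor (f1 g1 f2 g2 : R -> R) (h : R * R -> R) (F1 G1 F2 G2 : R) :
  mu.-integrable setT (EFin \o f1) /\ \int[mu]_x f1 x = F1 ->
  mu.-integrable setT (EFin \o g1) /\ \int[mu]_x g1 x = G1 ->
  mu.-integrable setT (EFin \o f2) /\ \int[mu]_x f2 x = F2 ->
  mu.-integrable setT (EFin \o g2) /\ \int[mu]_x g2 x = G2 ->
  h =1 (fun z => f1 z.1 * g1 z.2 - f2 z.1 * g2 z.2) ->
  (leb2 R).-integrable setT (EFin \o h) /\
  Rintegral (leb2 R) setT h = F1 * G1 - F2 * G2.
Proof.
move=> [f1i <-] [g1i <-] [f2i <-] [g2i <-] /funext ->.
have i1 := integrable_tensor _ _ f1i g1i.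
have i2 := integrable_tensor _ _ f2i g2i.
split; first by rewrite /comp; under eq_fun do rewrite EFinB; exact: integrableB.
by rewrite RintegralB// !Rintegral_tensor.
Qed.

Lemma integral2_cosWW :
  (leb2 R).-integrable setT (EFin \o (fun z => cos (ph z) * WW z)) /\
  Rintegral (leb2 R) setT (fun z => cos (ph z) * WW z) = cos th * gauss_ft.
Proof.
have := @add_tensor _ _ _ _ (fun z => cos (ph z) * WW z) _ _ _ _
  (@integral_cosW R m a p 0 a0) (@integral_cosW R n b q th b0)
  (@integral_sinW R m a p 0 a0) (@integral_sinW R n b q th b0).
rewrite cos0 sin0 !mul0r subr0 mul1r => -[|h1 h2].
  by move=> z /=; rewrite -(addrA _ (_ * q)) -[X in cos (X + _)]addr0 cosD; ring.
by split=> //; rewrite h2 /gauss_ft; ring.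
Qed.

Lemma integral2_xcosWW :
  (leb2 R).-integrable setT (EFin \o (fun z => (z.1 - m) * (cos (ph z) * WW z))) /\
  Rintegral (leb2 R) setT (fun z => (z.1 - m) * (cos (ph z) * WW z)) =
    - (a ^+ 2 * p * sin th * gauss_ft).
Proof.
have := @add_tensor _ _ _ _ (fun z => (z.1 - m) * (cos (ph z) * WW z)) _ _ _ _
  (@integral_xcosW R m a p 0 a0) (@integral_cosW R n b q th b0)
  (@integral_xsinW R m a p 0 a0) (@integral_sinW R n b q th b0).
rewrite cos0 sin0 => -[|h1 h2].
  by move=> z /=; rewrite -(addrA _ (_ * q)) -[X in cos (X + _)]addr0 cosD; ring.
by split=> //; rewrite h2 /gauss_ft; ring.
Qed.

Lemma integral2_tcosWW :
  (leb2 R).-integrable setT (EFin \o (fun z => (z.2 - n) * (cos (ph z) * WW z))) /\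
  Rintegral (leb2 R) setT (fun z => (z.2 - n) * (cos (ph z) * WW z)) =
    - (b ^+ 2 * q * sin th * gauss_ft).
Proof.
have := @add_tensor _ _ _ _ (fun z => (z.2 - n) * (cos (ph z) * WW z)) _ _ _ _
  (@integral_cosW R m a p 0 a0) (@integral_xcosW R n b q th b0)
  (@integral_sinW R m a p 0 a0) (@integral_xsinW R n b q th b0).
rewrite cos0 sin0 => -[|h1 h2].
  by move=> z /=; rewrite -(addrA _ (_ * q)) -[X in cos (X + _)]addr0 cosD; ring.
by split=> //; rewrite h2 /gauss_ft; ring.
Qed.

End fourier2.

(** * Measurability and integrability of Schwartz functions *)

Section measurable2.
Context {R : realType}.

Let box (q r e : rat) : set (R * R) :=
  `]ratr q - ratr e, ratr q + ratr e[%classic `*` `]ratr r - ratr e, ratr r + ratr e[%classic.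

(** The product sigma-algebra is generated by rectangles, and an open set is the countable union of
    the rational squares that it contains. *)
Lemma open_measurable2 (A : set (R * R)) : open A -> measurable A.
Proof.
move=> oA.
have -> : A = \bigcup_q \bigcup_r \bigcup_e
    (if pselect (box q r e `<=` A) then box q r e else set0).
  apply/seteqP; split => [x Ax|x [q _] [r _] [e _]]; last by case: pselect => // h /h.
  have /nbhs_ballP[e /= e0 he] := open_nbhs_nbhs (conj oA Ax).
  (* Half of [e]: the centre is within [d] of [x] and the square has half-side [d], so its points
     are within 2 d < e of [x]. *)
  have [d] := @rat_in_itvoo R 0 (e / 2) (divr_gt0 e0 (ltr0Sn _ _)).
  rewrite in_itv/= => /andP[d0 de].
  have [q] := @rat_in_itvoo R (x.1 - ratr d) (x.1 + ratr d) ltac:(lra).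
  rewrite in_itv/= => /andP[q1 q2].
  have [r] := @rat_in_itvoo R (x.2 - ratr d) (x.2 + ratr d) ltac:(lra).
  rewrite in_itv/= => /andP[r1 r2].
  exists q => //; exists r => //; exists d => //.
  case: (pselect (box q r d `<=` A)) => [_|nh] /=.
    by split => /=; rewrite in_itv/=; apply/andP; split; lra.
  exfalso; apply: nh => y [/=]; rewrite !in_itv/= => /andP[y1 y2] /andP[y3 y4].
  by apply: he; split; rewrite /ball/= ltr_norml; apply/andP; split; lra.
apply: bigcupT_measurable_rat => q; apply: bigcupT_measurable_rat => r.
apply: bigcupT_measurable_rat => e; case: (pselect (box q r e `<=` A)) => //= _.
by apply: measurableX; exact: measurable_itv.
Qed.

Lemma continuous_measurable2 (f : R * R -> R) : continuous f -> measurable_fun setT f.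
Proof.
move=> /continuousP cf; apply: (measurability _ (RGenOpens.measurableE R)).
move=> _ [_ [a [b ->] <-]]; rewrite setTI; apply: open_measurable2.
exact/cf/interval_open.
Qed.

End measurable2.

Section schwartz_integrable.
Context {R : realType}.
Notation mu := (@lebesgue_measure R).

Lemma oneDsqrV_integrable : mu.-integrable setT (EFin \o (fun x : R => (1 + x ^+ 2)^-1)).
Proof.
have c : continuous (fun x : R => (1 + x ^+ 2)^-1).
  by move=> x; exact: (@continuous_oneDsqrV R).
have p (x : R) : 0 <= (1 + x ^+ 2)^-1 by rewrite invr_ge0 addr_ge0// sqr_ge0.
apply/integrableP; split.
  by apply/measurable_EFinP; exact: continuous_measurable_fun.
under eq_integral do rewrite /= ger0_norm//.
rewrite ge0_symfun_integralT//; last by move=> x /=; rewrite sqrrN.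
have -> : [set x : R | 0 <= x] = `[0, +oo[%classic.
  by apply/seteqP; split => x /=; rewrite in_itv/= andbT.
by rewrite (@integral0y_oneDsqr R) -EFinM ltry.
Qed.

Lemma schwartz_real_continuous (f : R * R -> R) : schwartz_real f -> continuous f.
Proof. by move=> /(_ [::]) [h _] z; exact: differentiable_continuous. Qed.

Lemma schwartz_real_measurable (f : R * R -> R) : schwartz_real f -> measurable_fun setT f.
Proof. by move=> /schwartz_real_continuous; exact: continuous_measurable2. Qed.

Lemma schwartz_real_bounded (f : R * R -> R) : schwartz_real f ->
  exists M, forall z, `|f z| <= M.
Proof.
move=> /(_ [::]) [_ /(_ 0%N 0%N)[M hM]]; exists M => z.
by have := hM z; rewrite !expr0 !mul1r.
Qed.

(** The four seminorms with exponents 0 and 2 add up to a bound of |f| (1 + x^2) (1 + t^2), and the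
    reciprocal of this weight is an integrable tensor product. *)
Lemma schwartz_real_integrable (f : R * R -> R) : schwartz_real f ->
  (leb2 R).-integrable setT (EFin \o f).
Proof.
move=> sf; have mf := schwartz_real_measurable _ sf.
have [_ h] := sf [::].
have [M0 h0] := h 0%N 0%N; have [M1 h1] := h 2%N 0%N.
have [M2 h2] := h 0%N 2%N; have [M3 h3] := h 2%N 2%N.
have key (z : R * R) : `|f z| <= (M0 + M1 + M2 + M3) * ((1 + z.1 ^+ 2)^-1 * (1 + z.2 ^+ 2)^-1).
  have := h0 z; have := h1 z; have := h2 z; have := h3 z => /=.
  rewrite !expr0 !mulr1 !mul1r !real_normK ?num_real// => g3 g2 g1 g0.
  have p1 : 0 < 1 + z.1 ^+ 2 by rewrite ltr_pwDl// sqr_ge0.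
  have p2 : 0 < 1 + z.2 ^+ 2 by rewrite ltr_pwDl// sqr_ge0.
  rewrite mulrA ler_pdivlMr// ler_pdivlMr//.
  have -> : `|f z| * (1 + z.2 ^+ 2) * (1 + z.1 ^+ 2) =
    `|f z| + z.1 ^+ 2 * `|f z| + z.2 ^+ 2 * `|f z| + z.1 ^+ 2 * z.2 ^+ 2 * `|f z| by ring.
  by rewrite !lerD.
have i := integrable_tensor _ _ oneDsqrV_integrable oneDsqrV_integrable.
have {}i := integrableZl measurableT (M0 + M1 + M2 + M3) i.
apply: le_integrable i => //; first exact/measurable_EFinP.
by move=> z _; rewrite /= lee_fin (le_trans (key z))// ler_norm.
Qed.

End schwartz_integrable.

(** * Gaussian wave functions are Schwartz *)

Section gauss_class.
Context {R : realType}.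

Lemma is_derive_comp1 (f : R * R -> R) (g : R -> R) (z v : R * R) (df dg : R) :
  differentiable f z -> is_derive z v f df -> is_derive (f z) (1:R) g dg ->
  differentiable (g \o f) z /\ is_derive z v (g \o f) (dg * df).
Proof.
move=> fz [_ <-] [dg1 <-].
have gz : differentiable g (f z) by exact/derivable1_diffP.
have gf := differentiable_comp fz gz.
split; first exact: gf.
split; first exact: diff_derivable.
rewrite deriveE// diff_comp//= -(deriveE _ fz) [in RHS](deriveE _ gz).
by rewrite -[X in 'd g _ X]mulr1 linearZ/= mulrC.
Qed.

Lemma differentiable_fst (z : R * R) : differentiable (fst : R * R -> R) z.
Proof. by apply: linear_differentiable => y; exact: cvg_fst. Qed.

Lemma differentiable_snd (z : R * R) : differentiable (snd : R * R -> R) z.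
Proof. by apply: linear_differentiable => y; exact: cvg_snd. Qed.

Lemma is_derive_fst (z v : R * R) : is_derive z v (fst : R * R -> R) v.1.
Proof.
split; first exact/diff_derivable/differentiable_fst.
rewrite deriveE; last exact: differentiable_fst.
by rewrite diff_lin// => y; exact: cvg_fst.
Qed.

Lemma is_derive_snd (z v : R * R) : is_derive z v (snd : R * R -> R) v.2.
Proof.
split; first exact/diff_derivable/differentiable_snd.
rewrite deriveE; last exact: differentiable_snd.
by rewrite diff_lin// => y; exact: cvg_snd.
Qed.

(** The free phase [ga] lets one cosine stand for sines and derivatives too, since - sin is the
    cosine advanced by pi / 2. *)
Definition gauss_wave (a b al be ga : R) (z : R * R) : R :=
  expR (- (a * z.1 ^+ 2 + b * z.2 ^+ 2)) * cos (al * z.1 + be * z.2 + ga).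

(* A class of functions stable under [pderiv] which contains the packets, their moments
   and the test functions, so that membership in the Schwartz space is one induction. *)
Inductive gauss_class : (R * R -> R) -> Prop :=
| gauss_class_wave a b al be ga :
    0 < a -> 0 < b -> gauss_class (gauss_wave a b al be ga)
| gauss_class_fst f : gauss_class f -> gauss_class (fun z => z.1 * f z)
| gauss_class_snd f : gauss_class f -> gauss_class (fun z => z.2 * f z)
| gauss_class_add f g : gauss_class f -> gauss_class g -> gauss_class (fun z => f z + g z)
| gauss_class_scale c f : gauss_class f -> gauss_class (fun z => c * f z).

Let dir (time : bool) : R * R := if time then (0, 1) else (1, 0).

Let pderivE time (f : R * R -> R) z : pderiv time f z = 'D_(dir time) f z.
Proof. by case: time. Qed.

Lemma gauss_wave_derive (a b al be ga : R) (z v : R * R) :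
  differentiable (gauss_wave a b al be ga) z /\
  is_derive z v (gauss_wave a b al be ga)
   ((-2 * a * v.1) * (z.1 * gauss_wave a b al be ga z) +
    (-2 * b * v.2) * (z.2 * gauss_wave a b al be ga z) +
    (al * v.1 + be * v.2) * gauss_wave a b al be (ga + pi / 2) z).
Proof.
pose q1 : R * R -> R := - (a \*: (fst ^+ 2) + b \*: (snd ^+ 2)).
pose q2 : R * R -> R := al \*: fst + be \*: snd + cst ga.
have f1 := differentiable_fst z; have f2 := differentiable_snd z.
have d1 := is_derive_fst z v; have d2 := is_derive_snd z v.
have dq1 : differentiable q1 z.
  by apply: differentiableN; apply: differentiableD; apply: differentiableZ; exact: differentiableX.
have dq2 : differentiable q2 z.
  have fa : differentiable (al \*: (fst : R * R -> R)) z by exact: differentiableZ.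
  have fb : differentiable (be \*: (snd : R * R -> R)) z by exact: differentiableZ.
  exact: (differentiableD (differentiableD fa fb) (differentiable_cst ga z)).
have e1 : is_derive z v q1 (- (a * (2 * z.1 * v.1) + b * (2 * z.2 * v.2))).
  by apply: is_derive_eq; rewrite /GRing.scale/= !expr1.
have e2 : is_derive z v q2 (al * v.1 + be * v.2).
  by apply: is_derive_eq; rewrite /GRing.scale/= addr0.
have [g1 h1] := is_derive_comp1 _ expR _ _ _ _ dq1 e1 (is_derive_expR _).
have [g2 h2] := is_derive_comp1 _ (@cos R) _ _ _ _ dq2 e2 (is_derive_cos _).
have E : gauss_wave a b al be ga = (expR \o q1) * (@cos R \o q2).
  by apply/funext => y; rewrite /gauss_wave /q1 /q2 !fctE/= /GRing.scale/=.
rewrite {1 2}E; split; first exact: differentiableM.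
apply: (is_derive_eq (is_deriveM h1 h2)).
rewrite /gauss_wave addrA cosDpihalf /q1 /q2 !fctE/= /GRing.scale/=; ring.
Qed.

Lemma gauss_class_pderiv (f : R * R -> R) : gauss_class f ->
  (forall z, differentiable f z) /\ forall time, gauss_class (pderiv time f).
Proof.
elim=> [a b al be ga a0 b0|{}f cf [df IH]|{}f cf [df IH]|{}f g cf [df IHf] cg [dg IHg]|c {}f cf [df IH]].
- split=> [z|time]; first by have [] := gauss_wave_derive a b al be ga z 0.
  rewrite (_ : pderiv _ _ = fun z => ((-2 * a * (dir time).1) * (z.1 * gauss_wave a b al be ga z) +
    (-2 * b * (dir time).2) * (z.2 * gauss_wave a b al be ga z) +
    (al * (dir time).1 + be * (dir time).2) * gauss_wave a b al be (ga + pi / 2) z)).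
    apply: (gauss_class_add (fun z => _ * _ + _ * _) (fun z => _ * _)).
      apply: (gauss_class_add (fun z => _ * _) (fun z => _ * _)); apply: gauss_class_scale.
        by apply: gauss_class_fst; exact: gauss_class_wave.
      by apply: gauss_class_snd; exact: gauss_class_wave.
    by apply: gauss_class_scale; exact: gauss_class_wave.
  apply/funext => z; rewrite pderivE.
  by have [_ [_ ->]] := gauss_wave_derive a b al be ga z (dir time).
- split=> [z|time]; first by apply: (differentiableM (differentiable_fst z) (df z)).
  rewrite (_ : pderiv _ _ = fun z => z.1 * pderiv time f z + (dir time).1 * f z).
    apply: (gauss_class_add (fun z => _ * _) (fun z => _ * _)).
      exact: gauss_class_fst.
    exact: gauss_class_scale.
  apply/funext => z; rewrite !pderivE.
  have [d1 e1] := is_derive_fst z (dir time).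
  have := deriveM d1 (diff_derivable (df z) : derivable f z (dir time)).
  by rewrite e1 /GRing.scale/= [_ * f z]mulrC; apply.
- split=> [z|time]; first by apply: (differentiableM (differentiable_snd z) (df z)).
  rewrite (_ : pderiv _ _ = fun z => z.2 * pderiv time f z + (dir time).2 * f z).
    apply: (gauss_class_add (fun z => _ * _) (fun z => _ * _)).
      exact: gauss_class_snd.
    exact: gauss_class_scale.
  apply/funext => z; rewrite !pderivE.
  have [d1 e1] := is_derive_snd z (dir time).
  have := deriveM d1 (diff_derivable (df z) : derivable f z (dir time)).
  by rewrite e1 /GRing.scale/= [_ * f z]mulrC; apply.
- split=> [z|time]; first exact: (differentiableD (df z) (dg z)).
  rewrite (_ : pderiv _ _ = fun z => pderiv time f z + pderiv time g z).
    exact: gauss_class_add.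
  apply/funext => z; rewrite !pderivE.
  exact: (deriveD (diff_derivable (df z) : derivable f z (dir time)) (diff_derivable (dg z) : derivable g z (dir time))).
- split=> [z|time].
    have h : differentiable (c \*: f) z by apply: differentiableZ; exact: df.
    exact: h.
  rewrite (_ : pderiv _ _ = fun z => c * pderiv time f z).
    exact: gauss_class_scale.
  apply/funext => z; rewrite !pderivE.
  exact: (deriveZ c (diff_derivable (df z) : derivable f z (dir time))).
Qed.

(** The exponents are quantified inside the induction, because a factor [z.1] or [z.2] is absorbed
    by raising [k] or [l]. *)
Lemma gauss_class_decay (f : R * R -> R) : gauss_class f ->
  forall k l : nat, exists M, forall z, `|z.1| ^+ k * `|z.2| ^+ l * `|f z| <= M.
Proof.
elim=> [a b al be ga a0 b0|{}f cf IH|{}f cf IH|{}f g cf IHf cg IHg|c {}f cf IH] k l.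
- have [C C0 hC] := one_plus_abs_expR k _ a0.
  have [D D0 hD] := one_plus_abs_expR l _ b0.
  have aux (n : nat) (c E x : R) : (1 + `|x|) ^+ n <= E * expR (c * x ^+ 2) ->
      `|x| ^+ n * expR (- (c * x ^+ 2)) <= E.
    rewrite expRN ler_pdivrMr ?expR_gt0//; apply: le_trans.
    by rewrite lerXn2r ?nnegrE ?addr_ge0// lerDr.
  exists (C * D) => z.
  rewrite /gauss_wave normrM [`|expR _|]ger0_norm ?expR_ge0// opprD expRD.
  rewrite (_ : _ * _ = `|z.1| ^+ k * expR (- (a * z.1 ^+ 2)) *
     (`|z.2| ^+ l * expR (- (b * z.2 ^+ 2))) * `|cos (al * z.1 + be * z.2 + ga)|); last by ring.
  rewrite -[leRHS]mulr1 ler_pM//.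
  + by rewrite ler_pM ?aux// mulr_ge0 ?expR_ge0 ?exprn_ge0.
  + by rewrite ler_norml cos_geN1 cos_le1.
- have [M hM] := IH k.+1 l; exists M => z; apply: le_trans (hM z).
  by rewrite normrM exprS le_eqVlt; apply/orP; left; apply/eqP; ring.
- have [M hM] := IH k l.+1; exists M => z; apply: le_trans (hM z).
  by rewrite normrM exprS le_eqVlt; apply/orP; left; apply/eqP; ring.
- have [M hM] := IHf k l; have [N hN] := IHg k l; exists (M + N) => z.
  apply: (le_trans _ (lerD (hM z) (hN z))); by rewrite -mulrDr ler_wpM2l ?ler_normD// mulr_ge0 ?exprn_ge0.
- have [M hM] := IH k l; exists (`|c| * M) => z.
  by rewrite normrM mulrCA ler_wpM2l.
Qed.

Lemma gauss_class_schwartz (f : R * R -> R) : gauss_class f -> schwartz_real f.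
Proof.
move=> cf w; have : gauss_class (iter_pderiv w f).
  by elim: w => //= t w /gauss_class_pderiv[].
by move=> h; split; [have [] := gauss_class_pderiv _ h|exact: gauss_class_decay].
Qed.

End gauss_class.

(** * Schwartz functions as members of the completed spaces *)

Lemma cmod_sqr {R : realType} (w : R[i]) :
  cmod w ^+ 2 = complex.Re w ^+ 2 + complex.Im w ^+ 2.
Proof. by case: w => x y; rewrite /cmod/= sqr_sqrtr// addr_ge0// sqr_ge0. Qed.

Lemma Im_le_cmod {R : realType} (w : R[i]) : `|complex.Im w| <= cmod w.
Proof.
case: w => x y; rewrite /cmod/= -sqrtr_sqr ler_sqrt ?addr_ge0 ?sqr_ge0//.
by rewrite lerDr sqr_ge0.
Qed.

Section X_cst.
Context {R : realType}.
Variables (chi0 chi : R -> R) (b s : R).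

Lemma schwartz_Xnorm_ge0 u : (0 <= schwartz_Xnorm chi0 chi b s u)%E.
Proof.
apply: nneseries_ge0 => j _ _; rewrite mule_ge0 ?sqrte_ge0// lee_fin powR_ge0//.
Qed.

Lemma schwartz_Xnorm0 : schwartz_Xnorm chi0 chi b s (fun=> 0) = 0%E.
Proof.
have f0 y : fourier (fun _ : R * R => 0 : R[i]) y = 0.
  rewrite /fourier /cintegral; under eq_Rintegral do rewrite mulr0/=.
  under [X in _ +i* X]eq_Rintegral do rewrite mulr0/=.
  by rewrite /Rintegral integral0.
rewrite /schwartz_Xnorm eseries0// => j _ _.
under eq_integral do rewrite f0 cmod_sqr/= expr0n/= addr0 mulr0.
by rewrite integral0 sqrte0 mule0.
Qed.

Lemma X_approx_cst u : schwartz u -> X_approx chi0 chi b s (fun=> u) (dist_of u).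
Proof.
move=> su; split=> //.
  move=> e e0; exists 0%N => m n _ _.
  rewrite (_ : (fun z => _) = fun=> 0) ?schwartz_Xnorm0 ?lee_fin ?ltW//.
  by apply/funext => z; rewrite subrr.
move=> phi _; rewrite subrr (_ : cmod 0 = 0); first exact: cvg_cst.
by apply/eqP; rewrite -sqrf_eq0 cmod_sqr /= expr0n/= addr0.
Qed.

Lemma Xnorm_ge0 T : (0 <= Xnorm chi0 chi b s T)%E.
Proof.
apply: le_ereal_inf_tmp => N [f _]; apply: (@cvge_ge _ _ _ _ _ _ 0%E).
by apply: nearW => n; exact: schwartz_Xnorm_ge0.
Qed.

(** The constant sequence competes in the infimum; this is the source of all upper bounds on the
    right-hand side of the estimate. *)
Lemma Xnorm_le_schwartz u : schwartz u ->
  (Xnorm chi0 chi b s (dist_of u) <= schwartz_Xnorm chi0 chi b s u)%E.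
Proof.
move=> su; apply: ereal_inf_lbound; exists (fun=> u); first exact: X_approx_cst.
exact: cvg_cst.
Qed.

End X_cst.

Section dist_mul.
Context {R : realType}.

Lemma dist_mulxE (u : R * R -> R[i]) :
  dist_mulx (dist_of u) = dist_of (fun z => (z.1)%:C * u z).
Proof.
apply/funext => phi; rewrite /dist_mulx /dist_of; congr cintegral.
by apply/funext => z; rewrite mulrCA mulrA.
Qed.

Lemma dist_multE (u : R * R -> R[i]) :
  dist_mult (dist_of u) = dist_of (fun z => (z.2)%:C * u z).
Proof.
apply/funext => phi; rewrite /dist_mult /dist_of; congr cintegral.
by apply/funext => z; rewrite mulrCA mulrA.
Qed.

End dist_mul.

Section tempered.
Context {R : realType}.

Lemma schwartz_realM_integrable (f g : R * R -> R) : schwartz_real f -> schwartz_real g ->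
  (leb2 R).-integrable setT (fun z => (f z * g z)%:E).
Proof.
move=> sf sg; have [M hM] := schwartz_real_bounded _ sg.
have := integrableZl measurableT M (schwartz_real_integrable _ sf).
apply: le_integrable => //.
  by apply/measurable_EFinP; apply: measurable_funM; exact: schwartz_real_measurable.
move=> z _ /=; rewrite lee_fin !normrM mulrC ler_wpM2r//.
by rewrite (le_trans (hM z))// ler_norm.
Qed.

Lemma complex_ReM (v w : R[i]) : complex.Re (v * w) = complex.Re v * complex.Re w - complex.Im v * complex.Im w.
Proof. by case: v w => [? ?] []. Qed.

Lemma complex_ImM (v w : R[i]) : complex.Im (v * w) = complex.Re v * complex.Im w + complex.Im v * complex.Re w.
Proof. by case: v w => [? ?] []. Qed.

Lemma complex_Re_scale (v w : R[i]) (r : R) : complex.Re (v * (r%:C * w)) = r * complex.Re (v * w).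
Proof. by case: v w => [? ?] [? ?] /=; ring. Qed.

Lemma complex_Im_scale (v w : R[i]) (r : R) : complex.Im (v * (r%:C * w)) = r * complex.Im (v * w).
Proof. by case: v w => [? ?] [? ?] /=; ring. Qed.

Lemma schwartz_tempered (u : R * R -> R[i]) : schwartz u -> tempered_fun u.
Proof.
move=> [su1 su2]; split; first by split; exact: schwartz_real_measurable.
move=> phi [sp1 sp2]; split.
  under eq_fun do rewrite complex_ReM EFinB.
  by apply: integrableB => //; exact: schwartz_realM_integrable.
under eq_fun do rewrite complex_ImM EFinD.
by apply: integrableD => //; exact: schwartz_realM_integrable.
Qed.

End tempered.

(** * Upper bounds of the norms by Gaussian envelopes *)

Section cutoff_bounds.
Context {R : realType}.
Variables (chi0 chi : R -> R).
Hypotheses (hchi0 : is_chi0 chi0) (hchi : is_chi chi).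

Lemma chi_ge0 j z : 0 <= chi_ chi0 chi j z.
Proof.
case: j => [|j] /=.
  by have [[_ _ /(_ z)/andP[]]] := hchi0.
by have [[_ _ /(_ (2 ^- j.+1 * z))/andP[]]] := hchi.
Qed.

Lemma chi_le1 j z : chi_ chi0 chi j z <= 1.
Proof.
case: j => [|j] /=.
  by have [[_ _ /(_ z)/andP[]]] := hchi0.
by have [[_ _ /(_ (2 ^- j.+1 * z))/andP[]]] := hchi.
Qed.

Lemma chi_supp j z : chi_ chi0 chi j z != 0 -> 2 ^+ j <= 1 + 4 * `|z|.
Proof.
case: j => [|j] /=; first by rewrite expr0 lerDl mulr_ge0.
have [_ _ h] := hchi; move=> /eqP nz.
have : 4^-1 <= `|2 ^- j.+1 * z| <= 4 by apply: contrapT => /negP /h.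
move=> /andP[+ _]; rewrite normrM ger0_norm ?invr_ge0 ?exprn_ge0//.
rewrite [_^-1 * `|z|]mulrC ler_pdivlMr ?exprn_gt0//; lra.
Qed.

(** The fourth power of [chi_supp], with (1 + 4 |z|)^2 <= 20 (1 + z^2), whence 400 = 20^2. The decay
    16^-j leaves 4^-j after the square root in the norm, enough to sum against 2^(j/2). *)
Lemma chi_le_pow j z : chi_ chi0 chi j z <= 400 * 16 ^- j * (1 + z ^+ 2) ^+ 2.
Proof.
have [->|nz] := eqVneq (chi_ chi0 chi j z) 0.
  by apply: mulr_ge0; [apply: divr_ge0; [exact: ler0n|exact/exprn_ge0/ler0n]|exact: sqr_ge0].
apply: (le_trans (chi_le1 j z)).
have p0 : 0 < 2 ^+ j :> R by rewrite exprn_gt0.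
have h := chi_supp _ _ nz.
have -> : 16 ^+ j = (2 ^+ j) ^+ 4 :> R by rewrite exprAC; congr (_ ^+ _); rewrite -natrX.
rewrite mulrAC ler_pdivlMr ?exprn_gt0// mul1r.
have -> : 400 * (1 + z ^+ 2) ^+ 2 = (20 * (1 + z ^+ 2)) ^+ 2 by ring.
have -> : (2 ^+ j) ^+ 4 = ((2 ^+ j) ^+ 2) ^+ 2 :> R by ring.
rewrite lerXn2r ?nnegrE ?sqr_ge0//; first by rewrite mulr_ge0// addr_ge0 ?sqr_ge0.
have h2 : (2 ^+ j) ^+ 2 <= (1 + 4 * `|z|) ^+ 2.
  by rewrite lerXn2r ?nnegrE ?addr_ge0 ?mulr_ge0// ltW.
apply: (le_trans h2).
have -> : z ^+ 2 = `|z| ^+ 2 by rewrite real_normK ?num_real.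
have := sqr_ge0 (`|z| - 1); set t := `|z|; nra.
Qed.

Lemma powR2_half (j : nat) : (2 : R) `^ (j%:R * (1 / 2)) <= 2 ^+ j.
Proof.
rewrite -powR_mulrn// ler_powR//; first by rewrite ler1n.
by rewrite ler_piMr// ?ler0n//; lra.
Qed.

Lemma normal_peakV (a : R) : 0 < a -> (normal_peak a)^-1 = a * (normal_peak 1)^-1.
Proof.
move=> a0; rewrite /normal_peak !invrK expr1n mul1r -mulrnAr sqrtrM ?sqr_ge0//.
by rewrite sqrtr_sqr gtr0_norm.
Qed.

Lemma integral_normal2 (m n a b : R) : 0 < a -> 0 < b ->
  (\int[leb2 R]_y (normal_fun m a y.1 * normal_fun n b y.2)%:E =
   ((normal_peak a)^-1 * (normal_peak b)^-1)%:E)%E.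
Proof.
move=> a0 b0; have i1 := normal_fun_integrable m a a0.
have i2 := normal_fun_integrable n b b0.
have := Rintegral_tensor _ _ i1 i2; rewrite /Rintegral !normal_fun_integral//= => <-.
by rewrite fineK// integrable_fin_num//; exact: integrable_tensor.
Qed.

(** By [chi_le_pow] the sum over the shells becomes a geometric series, and one weighted integral of
    the transform controls the norm. There A is the squared height and 1 / a the xi-width. The
    degree 12 exceeds all those that the packets produce. *)
Lemma schwartz_Xnorm_le_gauss :
  exists2 D : R, 0 < D & forall (s nu nu' a A : R) (u : R * R -> R[i]),
  0 < a -> 0 <= A ->
  (forall y, (1 + (y.1 - omega y.2) ^+ 2) ^+ 2 * ((1 + `|y.2|) `^ (2 * s) * cmod (fourier u y) ^+ 2)
    <= A * ((1 + `|a * (y.2 - nu)|) ^+ 12 * expR (- (a * (y.2 - nu)) ^+ 2) *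
        ((1 + `|y.1 - nu'|) ^+ 12 * expR (- (y.1 - nu') ^+ 2)))) ->
  (schwartz_Xnorm chi0 chi (1 / 2) s u <= (D * Num.sqrt (A / a))%:E)%E.
Proof.
(* Half of the decay exp(- t^2) absorbs the polynomial; the other half is a [normal_fun]. *)
have [C C0 hC] := one_plus_abs_expR 12 (1 / 2) ltac:(lra) : exists2 C : R, _ & _.
have q0 : 0 < (normal_peak 1 : R)^-1 by rewrite invr_gt0 normal_peak_gt0// oner_neq0.
set q := (normal_peak 1)^-1 in q0.
(* 20 is the square root of 400; the remaining 2 rewrites 2^-j as twice 2^-(j+1), the terms of a
   series of sum 1. *)
exists (40 * C * q); first by rewrite !mulr_gt0.
move=> s nu nu' a A u a0 A0 hu.
have ai0 : 0 < a^-1 by rewrite invr_gt0.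
pose E (y : R * R) := normal_fun nu' 1 y.1 * normal_fun nu a^-1 y.2.
have hE (y : R * R) : A * ((1 + `|a * (y.2 - nu)|) ^+ 12 * expR (- (a * (y.2 - nu)) ^+ 2) *
    ((1 + `|y.1 - nu'|) ^+ 12 * expR (- (y.1 - nu') ^+ 2))) <= A * C ^+ 2 * E y.
  have aux (t : R) : (1 + `|t|) ^+ 12 * expR (- t ^+ 2) <= C * expR (- (t ^+ 2 / 2)).
    apply: (le_trans (ler_wpM2r (expR_ge0 _) (hC t))).
    by rewrite -mulrA -expRD le_eqVlt; apply/orP; left; apply/eqP; congr (_ * expR _); field.
  rewrite -[leRHS]mulrA ler_wpM2l// (_ : C ^+ 2 * E y = C * expR (- ((a * (y.2 - nu)) ^+ 2 / 2)) *
     (C * expR (- ((y.1 - nu') ^+ 2 / 2)))); last first.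
    rewrite /E !normal_funE// invrK divr1 [_ * a]mulrC; ring.
  by rewrite ler_pM// ?aux// mulr_ge0 ?expR_ge0 ?exprn_ge0 ?addr_ge0.
have term (j : nat) : ((2 `^ (j%:R * (1 / 2)))%:E * sqrte (\int[leb2 R]_y
       (chi_ chi0 chi j (y.1 - omega y.2) * (1 + `|y.2|) `^ (2 * s) *
        cmod (fourier u y) ^+ 2)%:E) <=
    ((40 * C * q * Num.sqrt (A / a)) / (2 ^ j.+1)%:R)%:E)%E.
  have le1 : (\int[leb2 R]_y (chi_ chi0 chi j (y.1 - omega y.2) * (1 + `|y.2|) `^ (2 * s) *
        cmod (fourier u y) ^+ 2)%:E <= \int[leb2 R]_y ((400 * 16 ^- j * (A * C ^+ 2))%:E * (E y)%:E))%E.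
    suff H (y : R * R) : 0 <= chi_ chi0 chi j (y.1 - omega y.2) * (1 + `|y.2|) `^ (2 * s) *
        cmod (fourier u y) ^+ 2 <= 400 * 16 ^- j * (A * C ^+ 2) * E y.
      apply: ge0_le_integralT => y; first by rewrite lee_fin; have /andP[] := H y.
      by rewrite -EFinM lee_fin; have /andP[] := H y.
    apply/andP; split.
      apply: mulr_ge0; last exact: sqr_ge0.
      by apply: mulr_ge0; [exact: chi_ge0|exact: powR_ge0].
    rewrite -!mulrA.
    apply: (@le_trans _ _ (400 * 16 ^- j * (1 + (y.1 - omega y.2) ^+ 2) ^+ 2 *
        ((1 + `|y.2|) `^ (2 * s) * cmod (fourier u y) ^+ 2))).
      by apply: ler_wpM2r; [rewrite mulr_ge0 ?powR_ge0 ?sqr_ge0|exact: chi_le_pow].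
    rewrite -[X in X <= _]mulrA !mulrA -[X in _ <= X]mulrA -[X in X <= _]mulrA.
    have c0 : 0 <= 400 / 16 ^+ j :> R by apply: divr_ge0; [exact: ler0n|exact/exprn_ge0/ler0n].
    by have := ler_wpM2l c0 (le_trans (hu y) (hE y)); rewrite !mulrA.
  have i1 := normal_fun_integrable nu' 1 ltr01.
  have i2 := normal_fun_integrable nu a^-1 ai0.
  rewrite integralZl// in le1; last exact: integrable_tensor.
  rewrite integral_normal2// -EFinM (normal_peakV a^-1 ai0) -/q in le1.
  have {}le1 := le_trans le1 (_ : (_ <= ((20 * 4 ^- j * C * q * Num.sqrt (A / a)) ^+ 2)%:E)%E).
  have h0 : 0 <= 20 * 4 ^- j * C * q * Num.sqrt (A / a).
    by rewrite !mulr_ge0 ?invr_ge0 ?exprn_ge0 ?sqrtr_ge0// ltW.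
  have {}le1 : (sqrte (\int[leb2 R]_y (chi_ chi0 chi j (y.1 - omega y.2) * (1 + `|y.2|) `^ (2 * s) *
        cmod (fourier u y) ^+ 2)%:E) <= (20 * 4 ^- j * C * q * Num.sqrt (A / a))%:E)%E.
    rewrite -[leRHS]gee0_abs// -sqrte_sqr lee_sqrt; last by rewrite expe_ge0.
    rewrite -EFin_expe; apply: le1; rewrite lee_fin.
    rewrite !exprMn sqr_sqrtr ?divr_ge0 ?(ltW a0)//.
    have -> : 16 ^- j = (4 ^- j) ^+ 2 :> R.
      by rewrite exprVn exprAC; congr (_ ^+ _)^-1; rewrite -natrX.
    by rewrite le_eqVlt; apply/orP; left; apply/eqP; ring.
  have pj : ((2 `^ (j%:R * (1 / 2)))%:E <= ((2 : R) ^+ j)%:E)%E.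
    by rewrite lee_fin powR2_half.
  have p0 : (0 <= ((2 : R) `^ (j%:R * (1 / 2)))%:E)%E by rewrite lee_fin powR_ge0.
  apply: (le_trans (lee_pmul p0 (sqrte_ge0 _) pj le1)); rewrite -EFinM lee_fin.
  rewrite le_eqVlt; apply/orP; left; apply/eqP; rewrite natrX exprS.
  have -> : 4 ^- j = (2 ^- j) ^+ 2 :> R.
    by rewrite exprVn exprAC; congr (_ ^+ _)^-1; rewrite -natrX.
  by field; rewrite expf_neq0.
apply: (@le_trans _ _ (\sum_(0 <= j <oo) ((40 * C * q * Num.sqrt (A / a)) / (2 ^ j.+1)%:R)%:E)%E).
  by apply: lee_nneseries => j *; rewrite ?mule_ge0 ?sqrte_ge0 ?lee_fin ?powR_ge0.
by apply: (epsilon_trick0 xpredT); rewrite !mulr_ge0 ?sqrtr_ge0// ltW.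
Qed.

End cutoff_bounds.

(** * Wave packets: transforms, modulation and norms *)

Section packet.
Context {R : realType}.

(* The phase is that of a plane wave of frequency [nu] solving the linear equation: its
   Fourier transform is concentrated where [lambda = omega xi]. *)
Definition packet (nu a : R) (z : R * R) : R[i] :=
  let th := nu ^+ 2 * z.2 - nu * z.1 in
  let W := normal_fun 0 a z.1 * normal_fun 0 1 z.2 in
  (cos th * W) +i* (sin th * W).

Lemma packet_gauss_class (nu a c : R) : 0 < a ->
  gauss_class (fun z : R * R => cos (nu ^+ 2 * z.2 - nu * z.1 + c) *
     (normal_fun 0 a z.1 * normal_fun 0 1 z.2)).
Proof.
move=> a0; rewrite (_ : (fun _ => _) = gauss_wave ((a ^+ 2)^-1 / 2) (1 / 2) (- nu) (nu ^+ 2) c).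
  by apply: gauss_class_wave; rewrite divr_gt0// ?invr_gt0 ?exprn_gt0.
apply/funext => z; rewrite /gauss_wave !normal_funE// -expRD mulrC; congr (expR _ * cos _).
  by field; rewrite gt_eqF.
by ring.
Qed.

Lemma Re_packet (nu a : R) : (fun z => complex.Re (packet nu a z)) =
  (fun z : R * R => cos (nu ^+ 2 * z.2 - nu * z.1 + 0) * (normal_fun 0 a z.1 * normal_fun 0 1 z.2)).
Proof. by apply/funext => z; rewrite addr0. Qed.

Lemma Im_packet (nu a : R) : (fun z => complex.Im (packet nu a z)) =
  (fun z : R * R => cos (nu ^+ 2 * z.2 - nu * z.1 + (- (pi / 2))) *
    (normal_fun 0 a z.1 * normal_fun 0 1 z.2)).
Proof. by apply/funext => z; rewrite cosBpihalf. Qed.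

Lemma schwartz_packet (nu a : R) : 0 < a -> schwartz (packet nu a).
Proof.
move=> a0; split; rewrite ?Re_packet ?Im_packet; apply: gauss_class_schwartz;
  exact: packet_gauss_class.
Qed.

Lemma schwartz_packet_x (nu a : R) : 0 < a -> schwartz (fun z => (z.1)%:C * packet nu a z).
Proof.
move=> a0; split; apply: gauss_class_schwartz.
  rewrite (_ : (fun _ => _) = (fun z => z.1 * complex.Re (packet nu a z))); last first.
    by apply/funext => z; rewrite complex_ReM/= mul0r subr0.
  by apply: gauss_class_fst; rewrite Re_packet; exact: packet_gauss_class.
rewrite (_ : (fun _ => _) = (fun z => z.1 * complex.Im (packet nu a z))); last first.
  by apply/funext => z; rewrite complex_ImM/= mul0r addr0.
by apply: gauss_class_fst; rewrite Im_packet; exact: packet_gauss_class.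
Qed.

Lemma schwartz_packet_t (nu a : R) : 0 < a -> schwartz (fun z => (z.2)%:C * packet nu a z).
Proof.
move=> a0; split; apply: gauss_class_schwartz.
  rewrite (_ : (fun _ => _) = (fun z => z.2 * complex.Re (packet nu a z))); last first.
    by apply/funext => z; rewrite complex_ReM/= mul0r subr0.
  by apply: gauss_class_snd; rewrite Re_packet; exact: packet_gauss_class.
rewrite (_ : (fun _ => _) = (fun z => z.2 * complex.Im (packet nu a z))); last first.
  by apply/funext => z; rewrite complex_ImM/= mul0r addr0.
by apply: gauss_class_snd; rewrite Im_packet; exact: packet_gauss_class.
Qed.

Section fourier_packet.
Variables (nu a : R) (y : R * R).
Hypothesis a0 : 0 < a.
Notation p := (y.2 - nu).
Notation q := (nu ^+ 2 - y.1).
Notation ft := (gauss_ft a 1 p q).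
Notation ph c z := ((z.1 - 0) * p + (z.2 - 0) * q + c).
Notation WW z := (normal_fun 0 a z.1 * normal_fun 0 1 z.2).

(** The phases of the exponential and the packet add up to one linear in [z], whose slopes are the
    offsets from the frequency of the packet. *)
Lemma Re_cexpi_packet (z : R * R) :
  complex.Re (cexpi (z.1 * y.2 - z.2 * y.1) * packet nu a z) = cos (ph 0 z) * WW z.
Proof.
rewrite complex_ReM /packet/= (_ : ph 0 z = (z.1 * y.2 - z.2 * y.1) + (nu ^+ 2 * z.2 - nu * z.1)).
  by rewrite [in RHS]cosD; ring.
by ring.
Qed.

Lemma Im_cexpi_packet (z : R * R) :
  complex.Im (cexpi (z.1 * y.2 - z.2 * y.1) * packet nu a z) = cos (ph (- (pi / 2)) z) * WW z.
Proof.
rewrite complex_ImM /packet/= (_ : ph (- (pi / 2)) z = (z.1 * y.2 - z.2 * y.1) + (nu ^+ 2 * z.2 - nu * z.1) - pi / 2).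
  by rewrite cosBpihalf [in RHS]sinD; ring.
by ring.
Qed.

Let sinN : sin (- (pi / 2)) = -1 :> R. Proof. by rewrite sinN sin_pihalf. Qed.
Let cosN : cos (- (pi / 2)) = 0 :> R. Proof. by rewrite cosN cos_pihalf. Qed.

Lemma fourier_packet : fourier (packet nu a) y = ft +i* 0.
Proof.
rewrite /fourier /cintegral; congr (_ +i* _).
  under eq_Rintegral do rewrite Re_cexpi_packet.
  by have [_ ->] := integral2_cosWW 0 0 a 1 p q 0 a0 ltr01; rewrite cos0 mul1r.
under eq_Rintegral do rewrite Im_cexpi_packet.
by have [_ ->] := integral2_cosWW 0 0 a 1 p q (- (pi / 2)) a0 ltr01; rewrite cosN mul0r.
Qed.

Lemma fourier_packet_x :
  fourier (fun z => (z.1)%:C * packet nu a z) y = 0 +i* (a ^+ 2 * p * ft).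
Proof.
rewrite /fourier /cintegral; congr (_ +i* _).
  under eq_Rintegral => z _.
    rewrite complex_Re_scale Re_cexpi_packet -[X in X * (_ * _)]subr0.
    over.
  by have [_ ->] := integral2_xcosWW 0 0 a 1 p q 0 a0 ltr01; rewrite sin0 mulr0 mul0r oppr0.
under eq_Rintegral => z _.
  rewrite complex_Im_scale Im_cexpi_packet -[X in X * (_ * _)]subr0.
  over.
by have [_ ->] := integral2_xcosWW 0 0 a 1 p q (- (pi / 2)) a0 ltr01; rewrite sinN; ring.
Qed.

Lemma fourier_packet_t :
  fourier (fun z => (z.2)%:C * packet nu a z) y = 0 +i* (q * ft).
Proof.
rewrite /fourier /cintegral; congr (_ +i* _).
  under eq_Rintegral => z _.
    rewrite complex_Re_scale Re_cexpi_packet -[X in X * (_ * _)]subr0.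
    over.
  by have [_ ->] := integral2_tcosWW 0 0 a 1 p q 0 a0 ltr01; rewrite sin0 mulr0 mul0r oppr0.
under eq_Rintegral => z _.
  rewrite complex_Im_scale Im_cexpi_packet -[X in X * (_ * _)]subr0.
  over.
by have [_ ->] := integral2_tcosWW 0 0 a 1 p q (- (pi / 2)) a0 ltr01; rewrite sinN; ring.
Qed.

End fourier_packet.

Section modulation.
Variables (nu a : R) (y : R * R).
Hypotheses (nu0 : 0 <= nu) (nua : nu <= a) (a1 : 1 <= a).
Notation P := (a * (y.2 - nu)).
Notation l := (y.1 - nu ^+ 2).

Lemma freq_le : `|y.2 - nu| <= `|P|.
Proof. by rewrite normrM ler_peMl// ger0_norm// (le_trans _ a1). Qed.

(** For xi >= 0 this is the Taylor expansion of xi^2 at [nu]. For xi < 0, where omega is - xi^2, the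
    distance nu + |xi| is large enough for the same bound. *)
Lemma modulation_le_freq :
  `|y.1 - omega y.2| <= `|l| + (2 * nu * `|y.2 - nu| + `|y.2 - nu| ^+ 2).
Proof.
have h3 : `|nu ^+ 2 - omega y.2| <= 2 * nu * `|y.2 - nu| + `|y.2 - nu| ^+ 2.
  rewrite /omega; have [xi0|xi0] := leP 0 y.2.
    rewrite (ger0_norm xi0) (_ : nu ^+ 2 - _ = - (2 * nu * (y.2 - nu) + (y.2 - nu) ^+ 2)); last by ring.
    by rewrite normrN (le_trans (ler_normD _ _))// normrX normrM ger0_norm// mulr_ge0.
  rewrite (ltr0_norm xi0) (_ : `|y.2 - nu| = nu - y.2); last by rewrite ltr0_norm ?opprB// subr_lt0 (lt_le_trans xi0).
  have nx : nu * y.2 <= 0 by rewrite mulr_ge0_le0// ltW.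
  rewrite mulNr opprK ger0_norm ?addr_ge0 -?expr2 ?sqr_ge0//.
  rewrite -subr_ge0 (_ : _ - _ = 2 * (nu ^+ 2 - 2 * (nu * y.2))); last by ring.
  by rewrite mulr_ge0// subr_ge0 (le_trans _ (sqr_ge0 nu))// pmulr_rle0.
apply: (@le_trans _ _ (`|l| + `|nu ^+ 2 - omega y.2|)); last by rewrite lerD2l.
by apply: le_trans (ler_normD _ _); rewrite addrA subrK.
Qed.

(** Here nu <= a matters: the slope 2 nu of omega times |xi - nu| is at most 2 |P|, so the packet
    stays at modulation O(1). *)
Lemma modulation_le : `|y.1 - omega y.2| <= (1 + `|l|) * (1 + `|P|) ^+ 2.
Proof.
have h1 := freq_le.
have h2 : nu * `|y.2 - nu| <= `|P|.
  by rewrite normrM ler_wpM2r// (le_trans nua)// ler_norm.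
have h4 := modulation_le_freq.
have h5 : `|y.2 - nu| ^+ 2 <= `|P| ^+ 2 by rewrite lerXn2r ?nnegrE.
have := normr_ge0 l; have := normr_ge0 P.
move: h1 h2 h4 h5; set A := `|_ - omega _|; set L := `|l|; set B := `|P|.
set E := `|y.2 - nu|; nra.
Qed.

Lemma modulation_sqr_le :
  (1 + (y.1 - omega y.2) ^+ 2) ^+ 2 <= 4 * ((1 + `|l|) ^+ 4 * (1 + `|P|) ^+ 8).
Proof.
have h := modulation_le.
set M := (1 + `|l|) * (1 + `|P|) ^+ 2 in h.
have M1 : 1 <= M.
  by rewrite /M mulr_ege1// ?exprn_ege1// lerDl.
have -> : 4 * ((1 + `|l|) ^+ 4 * (1 + `|P|) ^+ 8) = (2 * M ^+ 2) ^+ 2 by rewrite /M; ring.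
have h2 : (y.1 - omega y.2) ^+ 2 <= M ^+ 2.
  rewrite -[X in X <= _]real_normK ?num_real// lerXn2r ?nnegrE//.
  exact: le_trans M1.
rewrite lerXn2r ?nnegrE ?addr_ge0 ?sqr_ge0 ?mulr_ge0 ?sqr_ge0//.
by have : 1 <= M ^+ 2 := exprn_ege1 2 M1; lra.
Qed.

(** With [weightV_le], an inequality of Peetre type: the weight is frozen at [nu] at the cost of a
    factor that the Gaussian absorbs. *)
Lemma weight_le : (1 + `|y.2|) <= (1 + nu) * (1 + `|P|).
Proof.
have h : `|y.2| <= nu + `|P|.
  rewrite -[X in `|X|](subrKC nu) (le_trans (ler_normD _ _))//.
  by apply: lerD; [rewrite ger0_norm|exact: freq_le].
rewrite (_ : (1 + nu) * (1 + `|P|) = 1 + (nu + `|P|) + nu * `|P|); last by ring.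
apply: (@le_trans _ _ (1 + (nu + `|P|))); first by rewrite lerD2l.
by rewrite lerDl mulr_ge0.
Qed.

Lemma weightV_le : (1 + `|y.2|)^-1 <= (1 + `|P|) / (1 + nu).
Proof.
have n1 : 0 < 1 + nu by rewrite ltr_pwDl.
have x1 : 0 < 1 + `|y.2| by rewrite ltr_pwDl.
rewrite ler_pdivlMr// mulrC ler_pdivrMr//.
have h : nu <= `|y.2| + `|P|.
  apply: (@le_trans _ _ (`|y.2| + `|y.2 - nu|)); last by rewrite lerD2l freq_le.
  apply: (le_trans (ler_norm nu)).
  by rewrite -[X in `|X| <= _](subKr y.2) (le_trans (ler_normB _ _)).
have := normr_ge0 P; have := normr_ge0 y.2; move: h.
by set B := `|P|; set A := `|y.2|; nra.
Qed.

End modulation.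

End packet.

Section packet_norms.
Context {R : realType}.
Variables (chi0 chi : R -> R).
Hypotheses (hchi0 : is_chi0 chi0) (hchi : is_chi chi).

(** The squared norms are of order a^2 / a times the weight, which is at most 2 a. The factor [x]
    costs another a^2 and the dual weight gives back 1 / (1 + nu), hence the condition a <= 1 + nu.
    Both pairs (0, 1) and (N, N) are admissible. *)
Lemma schwartz_Xnorm_packet : exists2 K : R, 0 < K & forall nu a : R,
  0 <= nu -> nu <= a -> 1 <= a -> a <= 1 + nu ->
  [/\ (schwartz_Xnorm chi0 chi (1 / 2) (1 / 2) (packet nu a) <= (K * a)%:E)%E,
    (schwartz_Xnorm chi0 chi (1 / 2) (- (1 / 2)) (fun z => ((z.1)%:C * packet nu a z)%R) <= (K * a)%:E)%E &
    (schwartz_Xnorm chi0 chi (1 / 2) (1 / 2) (fun z => ((z.2)%:C * packet nu a z)%R) <= (K * a)%:E)%E].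
Proof.
have [D D0 hD] := schwartz_Xnorm_le_gauss chi0 chi hchi0 hchi.
have q0 : 0 < (normal_peak 1 : R)^-1 by rewrite invr_gt0 normal_peak_gt0// oner_neq0.
set q := (normal_peak 1)^-1 in q0.
exists (D * (4 * q ^+ 2)); first by rewrite !mulr_gt0 ?exprn_gt0.
move=> nu a nu0 nua a1 anu.
have a0 : 0 < a by apply: lt_le_trans a1.
have n1 : 0 < 1 + nu by rewrite ltr_pwDl.
have ftE (y : R * R) : gauss_ft a 1 (y.2 - nu) (nu ^+ 2 - y.1) ^+ 2 =
    a ^+ 2 * q ^+ 4 * (expR (- (a * (y.2 - nu)) ^+ 2) * expR (- (y.1 - nu ^+ 2) ^+ 2)).
  have E2 (t : R) : expR (- (t ^+ 2 / 2)) ^+ 2 = expR (- t ^+ 2).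
    by rewrite -expRM_natr; congr expR; field.
  rewrite /gauss_ft (normal_peakV a)// -/q mul1r -(opprB y.1) sqrrN -!E2.
  by set e1 := expR _; set e2 := expR _; ring.
have fin A : 0 <= A -> A / a <= (4 * q ^+ 2 * a) ^+ 2 ->
    ((D * Num.sqrt (A / a))%:E <= (D * (4 * q ^+ 2) * a)%:E)%E.
  move=> A0 hA; rewrite lee_fin -[leRHS]mulrA ler_pM2l//.
  have p0 : 0 <= 4 * q ^+ 2 * a by rewrite !mulr_ge0 ?sqr_ge0// ltW.
  by rewrite -[leRHS]ger0_norm// -sqrtr_sqr ler_wsqrtr.
(* Common reduction of the three bounds: [X] bounds the modulation, [Y] the weight and the moment,
   and their product may have any degrees up to 12. *)
have poly (y : R * R) (m n : nat) (X Y W A : R) : (m <= 12)%N -> (n <= 12)%N ->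
    0 <= X -> 0 <= A -> 0 <= W -> (1 + (y.1 - omega y.2) ^+ 2) ^+ 2 <= X ->
    W <= Y ->
    X * Y = A * ((1 + `|a * (y.2 - nu)|) ^+ m * (1 + `|y.1 - nu ^+ 2|) ^+ n) ->
    (1 + (y.1 - omega y.2) ^+ 2) ^+ 2 * (W * (expR (- (a * (y.2 - nu)) ^+ 2) * expR (- (y.1 - nu ^+ 2) ^+ 2)))
    <= A * ((1 + `|a * (y.2 - nu)|) ^+ 12 * expR (- (a * (y.2 - nu)) ^+ 2) *
        ((1 + `|y.1 - nu ^+ 2|) ^+ 12 * expR (- (y.1 - nu ^+ 2) ^+ 2))).
  move=> m12 n12 X0 A0 W0 hX hY e.
  set B := `|a * _|; set L := `|_ - nu ^+ 2|; set e1 := expR _; set e2 := expR _.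
  have p1 (t : R) (k : nat) : (k <= 12)%N -> 0 <= t -> (1 + t) ^+ k <= (1 + t) ^+ 12.
    by move=> k12 t0; rewrite ler_weXn2l// lerDl.
  have h1 : (1 + (y.1 - omega y.2) ^+ 2) ^+ 2 * W <= A * ((1 + B) ^+ 12 * (1 + L) ^+ 12).
    apply: (le_trans (ler_pM (sqr_ge0 _) W0 hX hY)); rewrite e ler_wpM2l//.
    by rewrite ler_pM ?exprn_ge0 ?addr_ge0 ?p1.
  have e0 : 0 <= e1 * e2 by rewrite mulr_ge0 ?expR_ge0.
  rewrite mulrA; apply: (le_trans (ler_wpM2r e0 h1)).
  by rewrite le_eqVlt; apply/orP; left; apply/eqP; ring.
have w1 (y : R * R) : (1 + `|y.2|) `^ (2 * (1 / 2)) <= (1 + nu) * (1 + `|a * (y.2 - nu)|).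
  rewrite (_ : 2 * (1 / 2) = 1); last by field.
  by rewrite powRr1 ?addr_ge0//; exact: weight_le.
have w2 (y : R * R) : (1 + `|y.2|) `^ (2 * (- (1 / 2))) <= (1 + `|a * (y.2 - nu)|) / (1 + nu).
  rewrite (_ : 2 * (- (1 / 2)) = -1); last by field.
  by rewrite powR_inv1 ?addr_ge0//; exact: weightV_le.
have mX (y : R * R) := modulation_sqr_le nu a y nu0 nua a1.
have X0 (y : R * R) : 0 <= 4 * ((1 + `|y.1 - nu ^+ 2|) ^+ 4 * (1 + `|a * (y.2 - nu)|) ^+ 8).
  by rewrite !mulr_ge0 ?exprn_ge0 ?addr_ge0.
have q40 : 0 <= q ^+ 4 by rewrite exprn_ge0// ltW.
have sq_le (t : R) : t ^+ 2 <= (1 + `|t|) ^+ 2.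
  by rewrite -[X in X <= _]real_normK ?num_real// lerXn2r ?nnegrE ?addr_ge0// lerDr.
have aq0 : 0 <= a ^+ 2 * q ^+ 4 by rewrite mulr_ge0 ?sqr_ge0.
pose EE (y : R * R) := expR (- (a * (y.2 - nu)) ^+ 2) * expR (- (y.1 - nu ^+ 2) ^+ 2).
have high A : A = 4 * (1 + nu) * (a ^+ 2 * q ^+ 4) -> A / a <= (4 * q ^+ 2 * a) ^+ 2.
  move=> ->; rewrite ler_pdivrMr// [leRHS](_ : _ = 4 * (4 * a) * (a ^+ 2 * q ^+ 4)); last by ring.
  rewrite ler_wpM2r// ler_pM2l//; lra.
have A1_ge0 : 0 <= 4 * (1 + nu) * (a ^+ 2 * q ^+ 4).
  by rewrite mulr_ge0// mulr_ge0// ltW.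
have A2_ge0 : 0 <= 4 * (a ^+ 4 * q ^+ 4) / (1 + nu).
  by rewrite divr_ge0 ?(ltW n1)// mulr_ge0// mulr_ge0// exprn_ge0// ltW.
split.
- apply: (le_trans (hD (1 / 2) nu (nu ^+ 2) a (4 * (1 + nu) * (a ^+ 2 * q ^+ 4)) _ a0 A1_ge0 _)).
    move=> y; rewrite fourier_packet// cmod_sqr/= expr0n/= addr0 ftE -/(EE y).
    rewrite [X in _ * X <= _](_ : _ = (1 + `|y.2|) `^ (2 * (1 / 2)) * (a ^+ 2 * q ^+ 4) * EE y);
      last by ring.
    (* The modulation has degree 8 in xi and 4 in lambda, the weight adds 1 in xi. In the next two
       cases [x] adds 2 in xi and [t] adds 2 in lambda. *)
    apply: (@poly y 9%N 4%N _ ((1 + nu) * (1 + `|a * (y.2 - nu)|) * (a ^+ 2 * q ^+ 4)) _ _ _ _ (X0 y) A1_ge0 _ (mX y)) => //.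
    + by apply: mulr_ge0; [exact: powR_ge0|].
    + by apply: ler_wpM2r.
    + by ring.
  exact: (fin _ A1_ge0 (high _ erefl)).
- apply: (le_trans (hD (- (1 / 2)) nu (nu ^+ 2) a (4 * (a ^+ 4 * q ^+ 4) / (1 + nu)) _ a0 A2_ge0 _)).
    move=> y; rewrite fourier_packet_x// cmod_sqr/= expr0n/= add0r exprMn ftE -/(EE y).
    rewrite [X in _ * X <= _](_ : _ = (1 + `|y.2|) `^ (2 * - (1 / 2)) *
      ((a ^+ 2 * (y.2 - nu)) ^+ 2 * (a ^+ 2 * q ^+ 4)) * EE y); last by ring.
    apply: (@poly y 11%N 4%N _ ((1 + `|a * (y.2 - nu)|) / (1 + nu) *
      ((a ^+ 2 * (1 + `|a * (y.2 - nu)|) ^+ 2) * (a ^+ 2 * q ^+ 4))) _ _ _ _ (X0 y) A2_ge0 _ (mX y)) => //.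
    + by apply: mulr_ge0; [exact: powR_ge0|apply: mulr_ge0; [exact: sqr_ge0|]].
    + apply: ler_pM; [exact: powR_ge0|by apply: mulr_ge0; [exact: sqr_ge0|]|by []|].
      apply: ler_wpM2r => //.
      rewrite (_ : a ^+ 2 * (y.2 - nu) = a * (a * (y.2 - nu))); last by ring.
      by rewrite exprMn; apply: ler_wpM2l; [exact: sqr_ge0|exact: sq_le].
    + by ring.
  apply: (fin _ A2_ge0); rewrite ler_pdivrMr//.
  have h : a / (1 + nu) <= 1 by rewrite ler_pdivrMr// mul1r.
  have a3 : 0 <= a ^+ 3 * q ^+ 4 by rewrite mulr_ge0// exprn_ge0// ltW.
  rewrite [leRHS](_ : _ = (a ^+ 3 * q ^+ 4) * 16); last by ring.
  rewrite [leLHS](_ : _ = (a ^+ 3 * q ^+ 4) * (4 * (a / (1 + nu)))); last by ring.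
  by rewrite ler_wpM2l//; lra.
- apply: (le_trans (hD (1 / 2) nu (nu ^+ 2) a (4 * (1 + nu) * (a ^+ 2 * q ^+ 4)) _ a0 A1_ge0 _)).
    move=> y; rewrite fourier_packet_t// cmod_sqr/= expr0n/= add0r exprMn ftE -/(EE y).
    rewrite [X in _ * X <= _](_ : _ = (1 + `|y.2|) `^ (2 * (1 / 2)) *
      ((y.1 - nu ^+ 2) ^+ 2 * (a ^+ 2 * q ^+ 4)) * EE y); last by ring.
    apply: (@poly y 9%N 6%N _ ((1 + nu) * (1 + `|a * (y.2 - nu)|) *
      ((1 + `|y.1 - nu ^+ 2|) ^+ 2 * (a ^+ 2 * q ^+ 4))) _ _ _ _ (X0 y) A1_ge0 _ (mX y)) => //.
    + by apply: mulr_ge0; [exact: powR_ge0|apply: mulr_ge0; [exact: sqr_ge0|]].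
    + apply: ler_pM; [exact: powR_ge0|by apply: mulr_ge0; [exact: sqr_ge0|]|by []|].
      by apply: ler_wpM2r => //; exact: sq_le.
    + by ring.
  exact: (fin _ A1_ge0 (high _ erefl)).
Qed.

End packet_norms.

(** * Duality over the modulation shells *)

Lemma cauchy_schwarz_integral {d} {T : measurableType d} {R : realType}
    (mu : {measure set T -> \bar R}) (f g : T -> R) :
  measurable_fun setT f -> measurable_fun setT g ->
  (\int[mu]_x (`|f x * g x|)%:E <=
   sqrte (\int[mu]_x (f x ^+ 2)%:E) * sqrte (\int[mu]_x (g x ^+ 2)%:E))%E.
Proof.
move=> mf mg.
have L2 (h : T -> R) : Lnorm mu 2%:E (EFin \o h) = sqrte (\int[mu]_x (h x ^+ 2)%:E).
  rewrite unlock -poweR12_sqrt; last by apply: integral_ge0 => x _; rewrite lee_fin sqr_ge0.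
  congr (_ `^ _)%E; apply: eq_integral => x _ /=.
  by rewrite powR_mulrn// real_normK ?num_real.
have := @hoelder _ _ _ mu f g 2 2 mf mg ltac:(lra) ltac:(lra) ltac:(lra).
by rewrite Lnorm1 !L2.
Qed.

Section dyadic.
Context {R : realType}.
Variables (chi0 chi : R -> R).
Hypotheses (hchi0 : is_chi0 chi0) (hchi : is_chi chi).

(** For |z| > 1 the least j with |z| <= 2^j puts 2^-j |z| into ]1/2, 1]. The cutoffs need not form a
    partition of unity, but their sum is therefore at least 1. *)
Lemma chi_cover (z : R) : exists j, chi_ chi0 chi j z = 1.
Proof.
have [z1|z1] := leP `|z| 1; first by exists 0%N; have [_ h _] := hchi0; exact: h.
have ex : exists j, `|z| <= 2 ^+ j.
  exists (Num.bound `|z|); apply: (le_trans (ltW (archi_boundP (normr_ge0 z)))).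
  by rewrite -natrX ler_nat ltnW// ltn_expl.
case: (ex_minnP ex) => -[|j] h1 h2; first by move: z1; rewrite ltNge -(expr0 2) h1.
exists j.+1 => /=; have [_ h _] := hchi; apply: h.
have p : 0 < 2 ^+ j.+1 :> R by rewrite exprn_gt0.
rewrite normrM gtr0_norm ?invr_gt0// [_ * `|z|]mulrC; apply/andP; split.
  rewrite ltr_pdivlMr// exprS mulKf// ltNge; apply/negP => /h2.
  by rewrite ltnn.
by rewrite ltr_pdivrMr// (le_lt_trans h1)// ltr_pMl//; lra.
Qed.

Lemma chi_sum_ge1 (z : R) : (1 <= \sum_(0 <= j <oo) (chi_ chi0 chi j z)%:E)%E.
Proof.
have [j hj] := chi_cover z.
apply: (@le_trans _ _ (\sum_(0 <= i < j.+1) (chi_ chi0 chi i z)%:E)%E); last first.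
  by apply: nneseries_lim_ge => i _ _; rewrite lee_fin chi_ge0.
rewrite big_nat_recr//= hj -[leLHS]add0e leeD//.
by apply: sume_ge0 => i _; rewrite lee_fin chi_ge0.
Qed.

Lemma smooth_measurable (f : R -> R) : smooth f -> measurable_fun setT f.
Proof.
move=> sf; apply: continuous_measurable_fun => z.
by apply: differentiable_continuous; apply/derivable1_diffP; exact: (sf 0%N).
Qed.

Lemma measurable_chi j : measurable_fun setT (chi_ chi0 chi j).
Proof.
have [[s0 _ _] _ _] := hchi0; have [[s1 _ _] _ _] := hchi.
case: j => [|j] /=; first exact: (smooth_measurable _ s0).
apply: (measurableT_comp (smooth_measurable _ s1)).
exact: measurable_funM.
Qed.

Lemma measurable_modulation : measurable_fun setT (fun y : R * R => y.1 - omega y.2).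
Proof.
apply: measurable_funB; first exact: measurable_fst.
apply: measurable_funM; last exact: measurable_snd.
by apply: measurableT_comp => //; exact: measurable_snd.
Qed.

Lemma powR2_half_sqr (j : nat) : ((2 : R) `^ (j%:R * - (1 / 2))) ^+ 2 = 2 ^- j.
Proof.
rewrite -powR_mulrn ?powR_ge0// -powRrM (_ : _ * 2%:R = - j%:R); last by field.
by rewrite powRN powR_mulrn.
Qed.

(* The weight in the hypothesis comes from [2 ^ j <= 1 + 4 |z|] on the support of
   [chi_ chi0 chi j]. *)
Lemma schwartz_Xnorm_dual (u : R * R -> R[i]) (h psi : R * R -> R) (kappa : R) :
  0 < kappa ->
  measurable_fun setT h -> measurable_fun setT psi -> (forall y, 0 <= psi y) ->
  (forall y, `|h y| <= cmod (fourier u y)) ->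
  (\int[leb2 R]_y ((1 + 4 * `|y.1 - omega y.2|) * (1 + `|y.2|)^-1 * psi y ^+ 2)%:E <= kappa%:E)%E ->
  (\int[leb2 R]_y (`|h y| * psi y)%:E <=
   (Num.sqrt kappa)%:E * schwartz_Xnorm chi0 chi (- (1 / 2)) (1 / 2) u)%E.
Proof.
move=> k0 mh mpsi psi0 hu hk.
pose c j (y : R * R) := chi_ chi0 chi j (y.1 - omega y.2).
have c0 j y : 0 <= c j y by exact: chi_ge0.
have mc j : measurable_fun setT (c j).
  by apply: (measurableT_comp (measurable_chi j)); exact: measurable_modulation.
have mhpsi : measurable_fun setT (fun y => `|h y| * psi y).
  by apply: measurable_funM => //; exact: measurableT_comp.
have w0 (y : R * R) : 0 < 1 + `|y.2| by rewrite ltr_pwDl.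
have mw : measurable_fun setT (fun y : R * R => 1 + `|y.2|).
  by apply: measurable_funD => //; apply: measurableT_comp => //; exact: measurable_snd.
have le1 : (\int[leb2 R]_y (`|h y| * psi y)%:E <=
    \sum_(0 <= j <oo) \int[leb2 R]_y (c j y * (`|h y| * psi y))%:E)%E.
  rewrite -integral_nneseries//; first last.
  - by move=> j y _; rewrite lee_fin mulr_ge0// mulr_ge0.
  - by move=> j; apply/measurable_EFinP; apply: measurable_funM; [exact: mc|exact: mhpsi].
  apply: ge0_le_integralT => y; first by rewrite lee_fin mulr_ge0.
  under eq_eseriesr do rewrite mulrC EFinM.
  rewrite nneseriesZl; last by move=> j _; rewrite lee_fin.
  rewrite -[leLHS]mule1; apply: lee_wpmul2l; first by rewrite lee_fin mulr_ge0.
  exact: chi_sum_ge1.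
apply: (le_trans le1); rewrite /schwartz_Xnorm -nneseriesZl; last first.
  by move=> j _; rewrite mule_ge0 ?sqrte_ge0// lee_fin powR_ge0.
apply: lee_nneseries => [j _ _|j _].
  by apply: integral_ge0 => y _; rewrite lee_fin mulr_ge0// mulr_ge0.
(* Cauchy-Schwarz on the shell j, with the weight in xi split between [F] and [G]. The factor
   2^(-j/2) of the norm comes out of [G]. *)
pose F (y : R * R) := Num.sqrt (c j y * (1 + `|y.2|)) * h y.
pose G (y : R * R) := Num.sqrt (c j y * (1 + `|y.2|)^-1) * psi y.
have mV : measurable_fun setT (fun y : R * R => (1 + `|y.2|)^-1).
  rewrite (_ : (fun _ => _) = (fun y : R * R => (1 + `|y.2|) `^ (- 1))).
    exact: (measurableT_comp (measurable_powR (-1))).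
  by apply/funext => y; rewrite powR_inv1// ltW.
have msqrt (f : R * R -> R) : measurable_fun setT f -> (forall y, 0 <= f y) ->
    measurable_fun setT (fun y => Num.sqrt (f y)).
  move=> mf f0; rewrite (_ : (fun _ => _) = (fun y => f y `^ 2^-1)).
    exact: (measurableT_comp (measurable_powR 2^-1)).
  by apply/funext => y; rewrite powR12_sqrt.
have mF : measurable_fun setT F.
  apply: measurable_funM => //; apply: msqrt; first exact: measurable_funM.
  by move=> y; rewrite mulr_ge0// ltW.
have mG : measurable_fun setT G.
  apply: measurable_funM => //; apply: msqrt; first exact: measurable_funM.
  by move=> y; rewrite mulr_ge0// invr_ge0 ltW.
have FG y : c j y * (`|h y| * psi y) = `|F y * G y|.
  have wn : 1 + `|y.2| != 0 by rewrite gt_eqF.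
  rewrite /F /G !normrM (ger0_norm (psi0 y)) !(ger0_norm (sqrtr_ge0 _)).
  rewrite mulrACA -sqrtrM ?mulr_ge0 ?(ltW (w0 y))//.
  have -> : c j y * (1 + `|y.2|) * (c j y / (1 + `|y.2|)) = c j y ^+ 2 by field.
  by rewrite sqrtr_sqr (ger0_norm (c0 j y)).
have CS := @cauchy_schwarz_integral _ _ _ (leb2 R) F G mF mG.
under eq_integral do rewrite FG.
apply: (le_trans CS).
have leF : (sqrte (\int[leb2 R]_y (F y ^+ 2)%:E) <=
    sqrte (\int[leb2 R]_y (c j y * (1 + `|y.2|) `^ (2 * (1 / 2)) * cmod (fourier u y) ^+ 2)%:E))%E.
  have cF y : F y ^+ 2 <= c j y * (1 + `|y.2|) `^ (2 * (1 / 2)) * cmod (fourier u y) ^+ 2.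
    rewrite /F exprMn sqr_sqrtr ?mulr_ge0 ?(ltW (w0 y))//.
    rewrite (_ : 2 * (1 / 2) = 1 :> R); last by field.
    rewrite powRr1 ?(ltW (w0 y))//; apply: ler_wpM2l; first by rewrite mulr_ge0 ?(ltW (w0 y)).
    rewrite -[X in X <= _]real_normK ?num_real// lerXn2r ?nnegrE//.
    exact: le_trans (hu y).
  rewrite lee_sqrt.
    by apply: ge0_le_integralT => y; rewrite lee_fin ?sqr_ge0.
  by apply: integral_ge0 => y _; rewrite lee_fin (le_trans _ (cF y))// sqr_ge0.
have leG : (sqrte (\int[leb2 R]_y (G y ^+ 2)%:E) <=
    (2 `^ (j%:R * - (1 / 2)) * Num.sqrt kappa)%:E)%E.
  have r0 : 0 <= 2 `^ (j%:R * - (1 / 2)) * Num.sqrt kappa.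
    by rewrite mulr_ge0 ?powR_ge0 ?sqrtr_ge0.
  have cG y : G y ^+ 2 <= 2 ^- j * ((1 + 4 * `|y.1 - omega y.2|) * (1 + `|y.2|)^-1 * psi y ^+ 2).
    have V0 : 0 <= (1 + `|y.2|)^-1 by rewrite invr_ge0 ltW.
    have X0 : 0 <= 2 ^- j * (1 + 4 * `|y.1 - omega y.2|).
      by rewrite mulr_ge0 ?invr_ge0 ?exprn_ge0 ?addr_ge0 ?mulr_ge0.
    rewrite /G exprMn sqr_sqrtr ?mulr_ge0//.
    have hc : c j y <= 2 ^- j * (1 + 4 * `|y.1 - omega y.2|).
      have [->//|nz] := eqVneq (c j y) 0.
      apply: (le_trans (chi_le1 _ _ hchi0 hchi j _)).
      rewrite mulrC ler_pdivlMr ?exprn_gt0// mul1r.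
      exact: (chi_supp _ _ hchi j (y.1 - omega y.2) nz).
    have P0 : 0 <= (1 + `|y.2|)^-1 * psi y ^+ 2 by apply: mulr_ge0; [|exact: sqr_ge0].
    by have := ler_wpM2r P0 hc; rewrite !mulrA.
  rewrite -[leRHS]gee0_abs ?lee_fin// -sqrte_sqr lee_sqrt; last by rewrite expe_ge0// lee_fin.
  rewrite -EFin_expe exprMn powR2_half_sqr sqr_sqrtr; last exact: ltW.
  apply: (@le_trans _ _ (\int[leb2 R]_y ((2 ^- j)%:E * ((1 + 4 * `|y.1 - omega y.2|) * (1 + `|y.2|)^-1 * psi y ^+ 2)%:E))%E).
    by apply: ge0_le_integralT => y; rewrite -?EFinM lee_fin ?sqr_ge0.
  have p0 (y : R * R) : 0 <= (1 + 4 * `|y.1 - omega y.2|) * (1 + `|y.2|)^-1 * psi y ^+ 2.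
    apply: mulr_ge0; last exact: sqr_ge0.
    by apply: divr_ge0; [rewrite addr_ge0// mulr_ge0|exact/ltW].
  rewrite ge0_integralZl//=.
  - by rewrite EFinM; apply: lee_wpmul2l => //; rewrite lee_fin invr_ge0 exprn_ge0.
  - apply/measurable_EFinP; apply: measurable_funM; last exact: measurable_funX.
    apply: measurable_funM => //; apply: measurable_funD => //.
    apply: measurable_funM => //; apply: measurableT_comp => //.
    exact: measurable_modulation.
  - by move=> y _; rewrite lee_fin.
apply: (le_trans (lee_pmul (sqrte_ge0 _) (sqrte_ge0 _) leF leG)).
by rewrite EFinM muleC -!muleA [X in (_ <= X)%E]muleCA.
Qed.

End dyadic.

(** * Moving the Fourier transform across a pairing *)

Section fubini_pairing.
Context {d1 d2 : measure_display} {T1 : measurableType d1} {T2 : measurableType d2}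
  {R : realType}.
Context {m1 : {sigma_finite_measure set T1 -> \bar R}}
  {m2 : {sigma_finite_measure set T2 -> \bar R}}.

Lemma integrable_bounded_mul {d} {T : measurableType d} {m : {measure set T -> \bar R}} (c g : T -> R) :
  measurable_fun setT c -> (forall t, `|c t| <= 1) ->
  m.-integrable setT (EFin \o g) -> m.-integrable setT (fun t => (c t * g t)%:E).
Proof.
move=> mc c1 gi; apply: (le_integrable measurableT _ _ gi).
  apply/measurable_EFinP; apply: measurable_funM => //.
  by apply/measurable_EFinP; exact: (measurable_int _ gi).
by move=> y _ /=; rewrite lee_fin normrM ler_piMl.
Qed.

Variables (c s : T1 * T2 -> R) (f g : T1 -> R) (psi : T2 -> R).
Hypotheses (fi : m1.-integrable setT (EFin \o f)) (gi : m1.-integrable setT (EFin \o g)).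
Hypothesis psi_int : m2.-integrable setT (EFin \o psi).
Hypotheses (mc : measurable_fun setT c) (ms : measurable_fun setT s).
Hypotheses (c1 : forall w, `|c w| <= 1) (s1 : forall w, `|s w| <= 1).

Let K (w : T1 * T2) : R := (c w * g w.1 + s w * f w.1) * psi w.2.

Let K_integrable : (m1 \x m2)%E.-integrable setT (EFin \o K).
Proof.
have i1 := integrable_bounded_mul _ _ mc c1 (integrable_tensor _ _ gi psi_int).
have i2 := integrable_bounded_mul _ _ ms s1 (integrable_tensor _ _ fi psi_int).
rewrite (_ : EFin \o K = (fun w => (c w * (g w.1 * psi w.2))%:E + (s w * (f w.1 * psi w.2))%:E)%E).
  exact: (integrableD measurableT i1 i2).
by apply/funext => w /=; rewrite -EFinD /K; congr EFin; ring.
Qed.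

Let K1 (z : T1) : (\int[m2]_y (K (z, y))%:E)%E =
  (g z * (\int[m2]_y (c (z, y) * psi y)) + f z * (\int[m2]_y (s (z, y) * psi y)))%:E.
Proof.
have i1 := integrable_bounded_mul _ _ (measurableT_comp mc (pair1_measurable z)) (fun y => c1 (z, y)) psi_int.
have i2 := integrable_bounded_mul _ _ (measurableT_comp ms (pair1_measurable z)) (fun y => s1 (z, y)) psi_int.
have j1 := integrableZl measurableT (g z) i1.
have j2 := integrableZl measurableT (f z) i2.
rewrite -[X in X + _]RintegralZl// -[X in _ + X]RintegralZl// -RintegralD//.
have ij := integrableD measurableT j1 j2.
rewrite /Rintegral fineK; last by apply: integrable_fin_num => //; exact: ij.
by apply: eq_integral => y _; rewrite /K/=; congr EFin; ring.
Qed.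

Let K2 (y : T2) : (\int[m1]_z (K (z, y))%:E)%E =
  ((\int[m1]_z (c (z, y) * g z + s (z, y) * f z)) * psi y)%:E.
Proof.
have i1 := integrable_bounded_mul _ _ (measurableT_comp mc (pair2_measurable y)) (fun z => c1 (z, y)) gi.
have i2 := integrable_bounded_mul _ _ (measurableT_comp ms (pair2_measurable y)) (fun z => s1 (z, y)) fi.
have i := integrableD measurableT i1 i2.
rewrite -RintegralZr// /Rintegral fineK//.
by apply: integrable_fin_num => //; under eq_fun do rewrite EFinM; exact: integrableZr.
Qed.

(** Both sides are iterated integrals of [K], which is integrable because [c] and [s] are bounded by
    1. With the cosine and sine of the Fourier phase it is the imaginary part of the multiplication
    formula. *)
Lemma fubini_pairing :
  \int[m1]_z (g z * (\int[m2]_y (c (z, y) * psi y)) + f z * (\int[m2]_y (s (z, y) * psi y))) =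
  \int[m2]_y ((\int[m1]_z (c (z, y) * g z + s (z, y) * f z)) * psi y).
Proof.
rewrite {1}/Rintegral [RHS]/Rintegral; congr fine.
under eq_integral do rewrite -K1.
under [RHS]eq_integral do rewrite -K2.
exact: Fubini K_integrable.
Qed.

Lemma measurable_pairing :
  measurable_fun setT (fun y => (\int[m1]_z (c (z, y) * g z + s (z, y) * f z)) * psi y).
Proof.
have := measurable_fubini_G K_integrable.
by rewrite /fubini_G; under eq_fun do rewrite K2; move/measurable_EFinP.
Qed.

End fubini_pairing.

(* The library proves products of sigma-finite measures sigma-finite, but its canonical
   instance on [\x] is overridden by that of probability measures. *)
Definition product_sigma_finite_measure {d1 d2} {T1 : measurableType d1}
    {T2 : measurableType d2} {R : realType} (m1 : {sigma_finite_measure set T1 -> \bar R})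
    (m2 : {sigma_finite_measure set T2 -> \bar R}) :
    {sigma_finite_measure set (T1 * T2)%type -> \bar R} :=
  HB.pack_for {sigma_finite_measure set (T1 * T2)%type -> \bar R} (m1 \x m2)%E
    (lebesgue_integral_fubini.measure_function_Measure_isSigmaFinite__to__measure_function_isSFinite
      m1 m2)
    (lebesgue_integral_fubini.measure_function_Measure_isSigmaFinite__to__measure_function_isSigmaFinite
      m1 m2).

Section pairing.
Context {R : realType}.
Variables (f phi : R * R -> R[i]) (psi : R * R -> R).
Hypothesis sf : schwartz f.
Hypothesis psi_gt0 : forall y, 0 < psi y.
Hypothesis psi_int : (leb2 R).-integrable setT (EFin \o psi).
Notation ph z y := (z.1 * y.2 - z.2 * y.1).
Hypothesis Re_phi : forall z, complex.Re (phi z) = Rintegral (leb2 R) setT (fun y => cos (ph z y) * psi y).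
Hypothesis Im_phi : forall z, complex.Im (phi z) = Rintegral (leb2 R) setT (fun y => sin (ph z y) * psi y).

Let mph : measurable_fun setT (fun w : (R * R) * (R * R) => ph w.1 w.2).
Proof.
apply: measurable_funB; apply: measurable_funM.
- exact: (measurableT_comp measurable_fst measurable_fst).
- exact: (measurableT_comp measurable_snd measurable_snd).
- exact: (measurableT_comp measurable_snd measurable_fst).
- exact: (measurableT_comp measurable_fst measurable_snd).
Qed.

Let m := product_sigma_finite_measure (@lebesgue_measure R) (@lebesgue_measure R).
Let c (w : (R * R) * (R * R)) : R := cos (ph w.1 w.2).
Let s (w : (R * R) * (R * R)) : R := sin (ph w.1 w.2).
Let mc : measurable_fun setT c.
Proof. by apply: (measurableT_comp _ mph); apply: continuous_measurable_fun; exact: continuous_cos. Qed.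
Let ms : measurable_fun setT s.
Proof. by apply: (measurableT_comp _ mph); apply: continuous_measurable_fun; exact: continuous_sin. Qed.
Let c1 w : `|c w| <= 1. Proof. by rewrite ler_norml cos_geN1 cos_le1. Qed.
Let s1 w : `|s w| <= 1. Proof. by rewrite ler_norml sin_geN1 sin_le1. Qed.
Let fi : (leb2 R).-integrable setT (EFin \o (fun z => complex.Re (f z))).
Proof. by have [h _] := sf; exact: schwartz_real_integrable. Qed.
Let gi : (leb2 R).-integrable setT (EFin \o (fun z => complex.Im (f z))).
Proof. by have [_ h] := sf; exact: schwartz_real_integrable. Qed.

(** The hypotheses on [phi] say that it is the integral of exp(i (x xi - t lambda)) against [psi],
    with the kernel of [fourier]; Fubini moves this kernel onto [f]. *)
Lemma Im_pairing : complex.Im (dist_of f phi) =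
  Rintegral (leb2 R) setT (fun y => complex.Im (fourier f y) * psi y).
Proof.
have := @fubini_pairing _ _ _ _ R m m c s _ _ psi fi gi psi_int mc ms c1 s1.
rewrite /c /s /=.
under eq_Rintegral do rewrite -Re_phi -Im_phi addrC -complex_ImM.
move=> ->; rewrite /fourier /cintegral /=.
apply: eq_Rintegral => y _; congr (_ * _); apply: eq_Rintegral => z _.
by rewrite complex_ImM.
Qed.

(** Fubini yields the measurability of the product with [psi], and [psi], being positive everywhere,
    is divided out. *)
Lemma measurable_Im_fourier : measurable_fun setT (fun y => complex.Im (fourier f y)).
Proof.
have mh := @measurable_pairing _ _ _ _ R m m c s _ _ psi fi gi psi_int mc ms c1 s1.
have mpsi : measurable_fun setT psi by apply/measurable_EFinP; exact: (measurable_int _ psi_int).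
have mV : measurable_fun setT (fun y : R * R => (psi y) `^ (- 1)).
  exact: (measurableT_comp (measurable_powR (-1))).
have := measurable_funM mh mV.
rewrite (_ : _ \* _ = (fun y => complex.Im (fourier f y)))//.
apply/funext => y /=; rewrite powR_inv1 ?(ltW (psi_gt0 y))// mulfK ?gt_eqF//.
by rewrite /fourier /cintegral /=; apply: eq_Rintegral => z _; rewrite complex_ImM.
Qed.

End pairing.

(** * Lower bounds in the completed space *)

Section Xnorm_lower.
Context {R : realType}.
Variables (chi0 chi : R -> R).
Hypotheses (hchi0 : is_chi0 chi0) (hchi : is_chi chi).
Variables (phi : R * R -> R[i]) (psi : R * R -> R) (kappa : R).
Hypothesis sphi : schwartz phi.
Hypothesis psi_gt0 : forall y, 0 < psi y.
Hypothesis psi_int : (leb2 R).-integrable setT (EFin \o psi).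
Notation ph z y := (z.1 * y.2 - z.2 * y.1).
Hypothesis Re_phi : forall z, complex.Re (phi z) = Rintegral (leb2 R) setT (fun y => cos (ph z y) * psi y).
Hypothesis Im_phi : forall z, complex.Im (phi z) = Rintegral (leb2 R) setT (fun y => sin (ph z y) * psi y).
Hypothesis kappa0 : 0 < kappa.
Hypothesis psi_kappa : (\int[leb2 R]_y
  ((1 + 4 * `|y.1 - omega y.2|) * (1 + `|y.2|)^-1 * psi y ^+ 2)%:E <= kappa%:E)%E.

Lemma Im_dist_le_schwartz_Xnorm (f : R * R -> R[i]) : schwartz f ->
  ((`|complex.Im (dist_of f phi)|)%:E <=
   (Num.sqrt kappa)%:E * schwartz_Xnorm chi0 chi (- (1 / 2)) (1 / 2) f)%E.
Proof.
move=> sf; rewrite (Im_pairing f phi psi sf psi_int Re_phi Im_phi).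
have mh := measurable_Im_fourier f psi sf psi_gt0 psi_int.
have mpsi : measurable_fun setT psi by apply/measurable_EFinP; exact: (measurable_int _ psi_int).
(* [Rintegral] reads 0 off an infinite integral; the inequality holds in that case too. *)
have fin_le (x : \bar R) : ((`|fine x|)%:E <= `|x|)%E.
  by case: x => [r||] //=; rewrite normr0 leey.
apply: (le_trans (fin_le _)).
apply: (le_trans (le_abse_integral _ _ _)) => //.
  by apply/measurable_EFinP; exact: measurable_funM.
have hle y : `|complex.Im (fourier f y)| <= cmod (fourier f y) by exact: Im_le_cmod.
have := schwartz_Xnorm_dual chi0 chi hchi0 hchi f (fun y => complex.Im (fourier f y)) psi kappa
  kappa0 mh mpsi (fun y => ltW (psi_gt0 y)) hle psi_kappa.
apply: le_trans; rewrite le_eqVlt; apply/orP; left; apply/eqP.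
by apply: eq_integral => y _; rewrite /= normrM (ger0_norm (ltW (psi_gt0 y))).
Qed.

(** The bound for the terms of an approximating sequence passes to the limit, as their pairings with
    [phi] tend to [T phi]. If [T] has no such sequence, the infimum is +oo. *)
Lemma Im_dist_le_Xnorm (T : Defs.distribution R) :
  ((`|complex.Im (T phi)| / Num.sqrt kappa)%:E <= Xnorm chi0 chi (- (1 / 2)) (1 / 2) T)%E.
Proof.
have k0 : 0 < Num.sqrt kappa by rewrite sqrtr_gt0.
apply: le_ereal_inf_tmp => N [f [sf _ wf] fN].
have {}wf := wf _ sphi.
pose c n := cmod (dist_of (f n) phi - T phi).
have cvg1 : ((`|complex.Im (T phi)| - c n) / Num.sqrt kappa)%:E @[n --> \oo] -->
    (`|complex.Im (T phi)| / Num.sqrt kappa)%:E.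
  rewrite -[X in _ --> (X / _)%:E]subr0.
  apply: cvg_EFin; first exact: nearW.
  by apply: cvgMl; apply: cvgB => //; exact: cvg_cst.
apply: (lee_cvg_to cvg1 fN); apply: nearW => n.
have h := Im_dist_le_schwartz_Xnorm _ (sf n).
have tri : `|complex.Im (T phi)| - c n <= `|complex.Im (dist_of (f n) phi)|.
  rewrite lerBlDr.
  have := Im_le_cmod (dist_of (f n) phi - T phi); rewrite -/(c n) => h2.
  have -> : complex.Im (T phi) = complex.Im (dist_of (f n) phi) - complex.Im (dist_of (f n) phi - T phi).
    by case: (dist_of (f n) phi) (T phi) => [? ?] [? ?] /=; ring.
  by rewrite (le_trans (ler_normB _ _))// lerD2l.
rewrite -(@lee_pmul2l _ (Num.sqrt kappa)%:E) ?lte_fin// -EFinM mulrCA divff ?gt_eqF// mulr1.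
by apply: le_trans h; rewrite lee_fin.
Qed.

End Xnorm_lower.

(** * The test function and its pairing with the product *)

Section integral_is.
Context {R : realType}.

Definition integral_is (f : R * R -> R) (v : R) : Prop :=
  (leb2 R).-integrable setT (EFin \o f) /\ Rintegral (leb2 R) setT f = v.

Lemma integral_isD f g v w : integral_is f v -> integral_is g w ->
  integral_is (fun y => f y + g y) (v + w).
Proof.
move=> [fi <-] [gi <-]; split; last by rewrite RintegralD.
exact: (integrableD measurableT fi gi).
Qed.

Lemma integral_isZ c f v : integral_is f v -> integral_is (fun y => c * f y) (c * v).
Proof.
move=> [fi <-]; split; last by rewrite RintegralZl.
exact: (integrableZl measurableT c fi).
Qed.

Lemma integral_is_sum (n : nat) (F : nat -> R * R -> R) (v : nat -> R) :
  (forall k, (k < n)%N -> integral_is (F k) (v k)) ->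
  integral_is (fun y => \sum_(k < n) F k y) (\sum_(k < n) v k).
Proof.
elim: n => [_|n IH h].
  rewrite big_ord0; under [X in integral_is X]funext do rewrite big_ord0.
  split; first by rewrite /comp; exact: integrable0.
  by rewrite /Rintegral integral0.
rewrite big_ord_recr /=; under [X in integral_is X]funext do rewrite big_ord_recr /=.
apply: integral_isD; last exact: h.
by apply: IH => k kn; apply: h; rewrite ltnW.
Qed.

Lemma integral_is_tensor (m n a b : R) : 0 < a -> 0 < b ->
  integral_is (fun y => normal_fun m a y.1 * normal_fun n b y.2)
    ((normal_peak a)^-1 * (normal_peak b)^-1).
Proof.
move=> a0 b0; have i1 := normal_fun_integrable m a a0; have i2 := normal_fun_integrable n b b0.
split; first exact: (integrable_tensor _ _ i1 i2).
by rewrite /Rintegral integral_normal2.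
Qed.

Lemma integral_is_le (f g : R * R -> R) v : (forall y, 0 <= f y) -> (forall y, f y <= g y) ->
  integral_is g v -> (\int[leb2 R]_y (f y)%:E <= v%:E)%E.
Proof.
move=> f0 fg [gi <-]; rewrite /Rintegral fineK; last exact: integrable_fin_num.
by apply: ge0_le_integralT => y; rewrite lee_fin.
Qed.

End integral_is.

Lemma gauss_class_sum {R : realType} (n : nat) (F : nat -> R * R -> R) :
  (forall k, gauss_class (F k)) -> gauss_class (fun z => \sum_(k < n.+1) F k z).
Proof.
move=> h; elim: n => [|n IH].
  by rewrite (_ : (fun _ => _) = F 0%N)//; apply/funext => z; rewrite big_ord_recl big_ord0 addr0.
rewrite (_ : (fun _ => _) = (fun z => \sum_(k < n.+1) F k z + F n.+1 z)).
  exact: gauss_class_add.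
by apply/funext => z; rewrite big_ord_recr.
Qed.

Section test_function.
Context {R : realType}.
Variable n : nat.
Notation N := (2 ^+ n : R).
Notation q := ((normal_peak (1 : R))^-1).

(** The xi-distance from N that corresponds to modulation of order 2^k, as omega has slope 2 N
    there; it is 1 for k = n. *)
Definition scale (k : nat) : R := 2 ^+ k / N.

(* Normalised so that the region of modulation about [2 ^ k] has weight [2 ^- k]. *)
Definition psik (k : nat) (y : R * R) : R :=
  2 ^- k * (normal_fun (N ^+ 2) 1 y.1 * normal_fun N (scale k) y.2).

Definition psi (y : R * R) : R := \sum_(k < n.+1) psik k y.

Definition wave (k : nat) (ga : R) : R * R -> R :=
  gauss_wave (scale k ^+ 2 / 2) (1 / 2) N (- N ^+ 2) ga.

Definition phi (z : R * R) : R[i] :=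
  (\sum_(k < n.+1) q ^+ 2 / N * wave k 0 z) +i*
  (\sum_(k < n.+1) q ^+ 2 / N * wave k (- (pi / 2)) z).

Let N0 : 0 < N. Proof. exact: exprn_gt0. Qed.
Let N1 : 1 <= N. Proof. by rewrite exprn_ege1// ler1n. Qed.

Lemma scale_gt0 k : 0 < scale k. Proof. by rewrite divr_gt0// exprn_gt0. Qed.

Lemma scale_le1 k : (k <= n)%N -> scale k <= 1.
Proof. by move=> kn; rewrite ler_pdivrMr// mul1r ler_weXn2l// ler1n. Qed.

Lemma psik_gt0 k y : 0 < psik k y.
Proof. by rewrite !mulr_gt0 ?invr_gt0 ?exprn_gt0 ?expR_gt0. Qed.

Lemma psi_gt0 y : 0 < psi y.
Proof.
rewrite /psi big_ord_recl ltr_pwDl ?psik_gt0//.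
by apply: sumr_ge0 => k _; exact/ltW/psik_gt0.
Qed.

Lemma psik_integral k : integral_is (psik k) (2 ^- k * (q * (normal_peak (scale k))^-1)).
Proof. by apply: integral_isZ; apply: integral_is_tensor => //; exact: scale_gt0. Qed.

Lemma psi_integrable : (leb2 R).-integrable setT (EFin \o psi).
Proof. by have [h _] := integral_is_sum n.+1 psik _ (fun k _ => psik_integral k). Qed.

(** The 2^-k of [psik] times the mass of a Gaussian of width [scale k] is of order 1 / N: all waves
    in [phi] have the same amplitude. The phases [c] = 0 and - pi / 2 give its real and imaginary
    parts. *)
Lemma cos_psik (z : R * R) (c : R) (k : nat) :
  integral_is (fun y => cos (z.1 * y.2 - z.2 * y.1 + c) * psik k y) (q ^+ 2 / N * wave k c z).
Proof.
have b0 := scale_gt0 k.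
have := integral2_cosWW (N ^+ 2) N 1 (scale k) (- z.2) z.1 (N * z.1 + (- N ^+ 2) * z.2 + c) ltr01 b0.
rewrite -/(integral_is _ _) => /(integral_isZ (2 ^- k)).
rewrite (_ : (fun y => _) = (fun y => cos (z.1 * y.2 - z.2 * y.1 + c) * psik k y)); last first.
  apply/funext => y; rewrite /psik mulrCA; congr (cos _ * _); ring.
congr (integral_is _ _); rewrite /gauss_ft (normal_peakV (scale k))// /wave /gauss_wave.
rewrite mulrCA -expRD.
rewrite (_ : - ((1 * - z.2) ^+ 2 / 2) + - ((scale k * z.1) ^+ 2 / 2) =
  - (scale k ^+ 2 / 2 * z.1 ^+ 2 + 1 / 2 * z.2 ^+ 2)); last by field.
set E := expR _; set c' := cos _.
have e : 2 ^- k * (q * (scale k * q)) = q ^+ 2 / N.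
  by set p := q; rewrite /scale; field; rewrite !expf_neq0 ?pnatr_eq0.
by rewrite -e; ring.
Qed.

Lemma Re_phi_psi z : complex.Re (phi z) =
  Rintegral (leb2 R) setT (fun y => cos (z.1 * y.2 - z.2 * y.1) * psi y).
Proof.
rewrite /phi [LHS]/=; have [_ <-] := integral_is_sum n.+1 _ _ (fun k _ => cos_psik z 0 k).
by apply: eq_Rintegral => y _; rewrite /psi mulr_sumr; apply: eq_bigr => k _; rewrite addr0.
Qed.

Lemma Im_phi_psi z : complex.Im (phi z) =
  Rintegral (leb2 R) setT (fun y => sin (z.1 * y.2 - z.2 * y.1) * psi y).
Proof.
rewrite /phi [LHS]/=; have [_ <-] := integral_is_sum n.+1 _ _ (fun k _ => cos_psik z (- (pi / 2)) k).
by apply: eq_Rintegral => y _; rewrite /psi mulr_sumr; apply: eq_bigr => k _; rewrite cosBpihalf.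
Qed.

Lemma wave_class k ga : gauss_class (wave k ga).
Proof. by apply: gauss_class_wave; rewrite divr_gt0// exprn_gt0// scale_gt0. Qed.

Lemma schwartz_phi : schwartz phi.
Proof.
have h ga : schwartz_real (fun z => \sum_(k < n.+1) q ^+ 2 / N * wave k ga z).
  apply: gauss_class_schwartz; apply: (gauss_class_sum n (fun k z => q ^+ 2 / N * wave k ga z)) => k.
  by apply: gauss_class_scale; exact: wave_class.
by split; exact: h.
Qed.

Definition envelope (k : nat) (z : R * R) : R :=
  expR (- (scale k ^+ 2 / 2 * z.1 ^+ 2 + 1 / 2 * z.2 ^+ 2)).

Lemma pderiv_sum_wave (ga : R) (z : R * R) :
  pderiv false (fun z => \sum_(k < n.+1) q ^+ 2 / N * wave k ga z) z =
  \sum_(k < n.+1) q ^+ 2 / N * ((- 2 * (scale k ^+ 2 / 2)) * (z.1 * wave k ga z) +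
     N * wave k (ga + pi / 2) z).
Proof.
rewrite /pderiv.
have d (k : 'I_n.+1) : is_derive z (1, 0) ((q ^+ 2 / N) \*: wave k ga)
   (q ^+ 2 / N * ((- 2 * (scale k ^+ 2 / 2)) * (z.1 * wave k ga z) +
     N * wave k (ga + pi / 2) z)).
  have [_ h] := gauss_wave_derive (scale k ^+ 2 / 2) (1 / 2) N (- N ^+ 2) ga z (1, 0).
  by apply: is_derive_eq; rewrite /GRing.scale/= !mulr1 !mulr0 mul0r !addr0.
have [_ <-] := is_derive_sum d.
by congr ('D_ _ _ _); apply/funext => y; rewrite fct_sumE.
Qed.

Notation W1 z := (normal_fun 0 1 z.1 * normal_fun 0 1 z.2).
Notation W2 z := (normal_fun 0 N z.1 * normal_fun 0 1 z.2).

(** The packets have the phase th and the waves - th, so the phases cancel. Of d_x the Gaussian part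
    is then real, and the imaginary part retains the factor N from the phase, which cancels 1 / N:
    the integrand is positive. *)
Lemma Im_pairing_packets (z : R * R) :
  complex.Im (packet 0 1 z * packet N N z *
    (pderiv false (fun z => complex.Re (phi z)) z +i* pderiv false (fun z => complex.Im (phi z)) z)) =
  \sum_(k < n.+1) q ^+ 2 * (W1 z * W2 z * envelope k z).
Proof.
have -> : (fun z => complex.Re (phi z)) = (fun z => \sum_(k < n.+1) q ^+ 2 / N * wave k 0 z) by [].
have -> : (fun z => complex.Im (phi z)) =
  (fun z => \sum_(k < n.+1) q ^+ 2 / N * wave k (- (pi / 2)) z) by [].
rewrite complex_ImM !pderiv_sum_wave [complex.Re (_ +i* _)]/= [complex.Im (_ +i* \sum_(_ < _) _)]/=.
rewrite !mulr_sumr -big_split/=.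
apply: eq_bigr => k _.
rewrite /packet /= /wave /gauss_wave -/(envelope k z).
rewrite expr0n/= !mul0r subrr cos0 sin0.
set th := N ^+ 2 * z.2 - N * z.1.
have ph c : N * z.1 + - N ^+ 2 * z.2 + c = c - th by rewrite /th; ring.
rewrite !ph.
rewrite (_ : - (pi / 2) - th = - (th + pi / 2)); last by ring.
rewrite (_ : 0 + pi / 2 - th = - (th - pi / 2)); last by ring.
rewrite (_ : - (pi / 2) + pi / 2 - th = - th); last by ring.
rewrite sub0r !cosN cosDpihalf cosBpihalf.
have cs := cos2Dsin2 th.
transitivity (q ^+ 2 * (W1 z * W2 z * envelope k z) * (cos th ^+ 2 + sin th ^+ 2)); last by rewrite cs mulr1.
move: (N0); set p := q; set M : R := N => M0.
by field; rewrite gt_eqF.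
Qed.

(** Each term is q^2 times a Gaussian with exponents at most 3/2 x^2 and 3/2 t^2, as N >= 1 and
    [scale k] <= 1. It dominates the product of Gaussians of width 1/2, with exponents 2 x^2 and 2
    t^2, whose integral is (q / 2)^2. *)
Lemma Im_test_lower :
  q ^+ 4 / 4 * n.+1%:R <=
  `|complex.Im (dist_dx (dist_of (fun z => packet 0 1 z * packet N N z)) phi)|.
Proof.
pose I (z : R * R) := \sum_(k < n.+1) q ^+ 2 * (W1 z * W2 z * envelope k z).
have -> : complex.Im (dist_dx (dist_of (fun z => packet 0 1 z * packet N N z)) phi) =
    - Rintegral (leb2 R) setT I.
  transitivity (- Rintegral (leb2 R) setT (fun z => complex.Im (packet 0 1 z * packet N N z *
    (pderiv false (fun z => complex.Re (phi z)) z +i* pderiv false (fun z => complex.Im (phi z)) z)))).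
    by [].
  by congr (- _); apply: eq_Rintegral => z _; rewrite Im_pairing_packets.
rewrite normrN; apply: le_trans (ler_norm _).
have q2 : 0 <= q ^+ 2 by exact: sqr_ge0.
have h2 : 0 < 1 / 2 :> R by lra.
have E1 (k : nat) z : envelope k z <= 1.
  rewrite /envelope -[leRHS]expR0 ler_expR oppr_le0 addr_ge0//.
    by rewrite mulr_ge0 ?sqr_ge0// divr_ge0 ?sqr_ge0.
  by rewrite mulr_ge0 ?sqr_ge0//; lra.
have nf1 (a x : R) : normal_fun 0 a x <= 1.
  rewrite /normal_fun -[leRHS]expR0 ler_expR mulNr oppr_le0 divr_ge0 ?sqr_ge0//.
  by rewrite mulrn_wge0// sqr_ge0.
have nf0 (a x : R) : 0 <= normal_fun 0 a x by exact: normal_fun_ge0.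
have E0 k z : 0 <= envelope k z by exact: expR_ge0.
have W20 (z : R * R) : 0 <= W2 z by rewrite mulr_ge0.
have W10 (z : R * R) : 0 <= W1 z by rewrite mulr_ge0.
have W21 (z : R * R) : W2 z <= 1 by rewrite mulr_ile1.
have up := integral_isZ (n.+1%:R * q ^+ 2) _ _ (integral_is_tensor 0 0 1 1 ltr01 ltr01).
have lo := integral_isZ (n.+1%:R * q ^+ 2) _ _ (integral_is_tensor 0 0 (1 / 2) (1 / 2) h2 h2).
have I_up z : `|I z| <= `|n.+1%:R * q ^+ 2 * W1 z|.
  rewrite !ger0_norm; last 2 first.
  - by rewrite mulr_ge0// mulr_ge0.
  - by apply: sumr_ge0 => k _; rewrite mulr_ge0// mulr_ge0// mulr_ge0.
  rewrite /I -[leRHS]mulrA -[n.+1 in leRHS]card_ord mulr_natl -sumr_const.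
  apply: ler_sum => k _; rewrite ler_wpM2l// -[leLHS]mulrA ler_piMr//.
  by rewrite mulr_ile1.
have mI : measurable_fun setT I.
  have c : schwartz_real (fun z : R * R => \sum_(k < n.+1) gauss_wave (scale k ^+ 2 / 2) (1 / 2) 0 0 0 z).
    apply: gauss_class_schwartz; apply: (gauss_class_sum n (fun k => gauss_wave (scale k ^+ 2 / 2) (1 / 2) 0 0 0)) => k.
    by apply: gauss_class_wave; rewrite divr_gt0// exprn_gt0// scale_gt0.
  have mW a : measurable_fun setT (fun z : R * R => normal_fun 0 a z.1 * normal_fun 0 1 z.2).
    by apply: measurable_funM; apply: measurableT_comp (measurable_normal_fun _ _) _;
      [exact: measurable_fst|exact: measurable_snd].
  rewrite (_ : I = fun z => q ^+ 2 * (W1 z * W2 z) * \sum_(k < n.+1) gauss_wave (scale k ^+ 2 / 2) (1 / 2) 0 0 0 z).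
    apply: measurable_funM; last exact: schwartz_real_measurable.
    by apply: measurable_funM => //; apply: measurable_funM; exact: mW.
  apply/funext => z; rewrite /I mulr_sumr; apply: eq_bigr => k _.
  have -> : gauss_wave (scale k ^+ 2 / 2) (1 / 2) 0 0 0 z = envelope k z.
    by rewrite /gauss_wave !mul0r !addr0 cos0 mulr1.
  exact: mulrA.
have Ii : (leb2 R).-integrable setT (EFin \o I).
  apply: (le_integrable measurableT _ _ up.1); first exact/measurable_EFinP.
  by move=> z _; rewrite /= lee_fin; exact: I_up.
have I_lo z : n.+1%:R * q ^+ 2 * (normal_fun 0 (1 / 2) z.1 * normal_fun 0 (1 / 2) z.2) <= I z.
  rewrite /I -[leLHS]mulrA -[n.+1 in leLHS]card_ord mulr_natl -sumr_const.
  apply: ler_sum => k _; rewrite ler_wpM2l// !normal_funE// /envelope -!expRD ler_expR.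
  have s1 : scale k ^+ 2 <= 1.
    by rewrite expr_le1 ?(ltW (scale_gt0 k))// scale_le1// -ltnS.
  have s2 : N^-1 ^+ 2 <= 1 by rewrite expr_le1 ?invr_ge0 ?(ltW N0)// invf_le1.
  move: s1 s2; set A := scale k ^+ 2; rewrite !subr0 !divr1 !exprMn.
  have := sqr_ge0 z.1; have := sqr_ge0 z.2; set B := N^-1 ^+ 2; set X := z.1 ^+ 2; set Y := z.2 ^+ 2.
  rewrite (_ : (1 / 2)^-1 ^+ 2 = 4); last by field.
  move=> Y0 X0 A1 B1; have := ler_wpM2l X0 A1; have := ler_wpM2l X0 B1; lra.
have [loi lov] := lo.
have -> : q ^+ 4 / 4 * n.+1%:R = Rintegral (leb2 R) setT
    (fun y => n.+1%:R * q ^+ 2 * (normal_fun 0 (1 / 2) y.1 * normal_fun 0 (1 / 2) y.2)).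
  by rewrite lov (normal_peakV (1 / 2))//; set p := q; field.
by apply: le_Rintegral => // z _; exact: I_lo.
Qed.

Variable C : R.
Hypothesis hC : forall p : R, (1 + `|p|) ^+ 3 <= C * expR (3 / 8 * p ^+ 2).
Notation V y := ((1 + 4 * `|y.1 - omega y.2|) * (1 + `|y.2|)^-1).

Definition wide (k : nat) (y : R * R) : R :=
  normal_fun (N ^+ 2) 2 y.1 * normal_fun N (2 * scale k) y.2.

Lemma weight_ge0 (y : R * R) : 0 <= V y.
Proof. by rewrite mulr_ge0 ?invr_ge0 ?addr_ge0 ?mulr_ge0. Qed.

(** On the bulk of [psik k] the modulation is O(2^k) and xi is of order N; the cubes in the
    normalised variables account for the tails. *)
Lemma weight_dyadic_le k (y : R * R) : (k <= n)%N ->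
  V y <= 4 * 2 ^+ k / N * ((1 + `|y.1 - N ^+ 2|) ^+ 3 * (1 + `|(y.2 - N) / scale k|) ^+ 3).
Proof.
move=> kn; have b0 := scale_gt0 k; have b1 := scale_le1 _ kn.
have K1 : 1 <= 2 ^+ k :> R by rewrite exprn_ege1// ler1n.
have hP : `|y.2 - N| = scale k * `|(y.2 - N) / scale k|.
  by rewrite normrM normfV (gtr0_norm b0) mulrCA divff ?mulr1// gt_eqF.
have hm := modulation_le_freq N y (ltW N0).
have hw := weightV_le N 1 y (ltW N0) (lexx 1).
rewrite mul1r hP in hw; rewrite hP in hm.
move: hw hm; set l := `|y.1 - N ^+ 2|; set Q := `|_ / _|; set mu := `|_ - omega _|.
have l0 : 0 <= l by exact: normr_ge0.
have Q0 : 0 <= Q by exact: normr_ge0.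
have mu0 : 0 <= mu by exact: normr_ge0.
move=> hw hm.
have NQ : 2 * N * (scale k * Q) = 2 * 2 ^+ k * Q by rewrite /scale; field; rewrite gt_eqF.
have sQ : (scale k * Q) ^+ 2 <= 2 ^+ k * Q ^+ 2.
  by rewrite exprMn ler_wpM2r ?sqr_ge0// (le_trans _ K1)// expr_le1// ltW.
have m1 : 1 + 4 * mu <= 4 * 2 ^+ k * ((1 + l) * (1 + Q) ^+ 2).
  move: hm; rewrite NQ => hm; move: K1 hm sQ; set A : R := 2 ^+ k => K1 hm sQ.
  have lA : l <= A * l by rewrite ler_peMl.
  have : 0 <= A * (l * (2 * Q + Q ^+ 2)).
    by apply: mulr_ge0; [lra|apply: mulr_ge0 => //; apply: addr_ge0; [lra|exact: sqr_ge0]].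
  lra.
have w1 : (1 + `|y.2|)^-1 <= (1 + Q) / N.
  apply: (le_trans hw); apply: ler_pM => //.
  - by rewrite addr_ge0// mulr_ge0// ltW.
  - by rewrite lerD2l ler_piMl.
  - by rewrite lef_pV2 ?posrE// ?addr_gt0// lerDr.
have l3 : 1 + l <= (1 + l) ^+ 3 by rewrite ler_eXnr// lerDl.
apply: (@le_trans _ _ (4 * 2 ^+ k * ((1 + l) * (1 + Q) ^+ 2) * ((1 + Q) / N))).
  by apply: ler_pM => //; rewrite ?invr_ge0 addr_ge0// mulr_ge0.
rewrite (_ : _ * ((1 + Q) / N) = 4 * 2 ^+ k / N * ((1 + l) * (1 + Q) ^+ 3)); last by ring.
apply: ler_wpM2l; first by rewrite divr_ge0 ?(ltW N0)// mulr_ge0// exprn_ge0.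
by rewrite ler_wpM2r// exprn_ge0// addr_ge0.
Qed.

(** The 2^k of the weight cancels the 2^-k of [psik], and the cubes are absorbed by doubling both
    widths, again with exponent 3/8. *)
Lemma weight_psik k y : (k <= n)%N -> V y * psik k y <= 4 * C ^+ 2 / N * wide k y.
Proof.
move=> kn; have b0 := scale_gt0 k.
apply: (le_trans (ler_wpM2r (ltW (psik_gt0 k y)) (weight_dyadic_le _ y kn))).
rewrite /psik /wide !normal_funE ?mulr_gt0// divr1.
have e2 : (y.2 - N) / (2 * scale k) = (y.2 - N) / scale k / 2 by field; rewrite gt_eqF.
rewrite e2; set l := y.1 - N ^+ 2; set Q := (y.2 - N) / scale k.
have k0 : 2 ^+ k != 0 :> R by rewrite expf_neq0.
have -> : forall a b : R, 4 * 2 ^+ k / N * a * (2 ^- k * b) = 4 / N * (a * b).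
  by move=> a b; field; rewrite k0 gt_eqF.
rewrite (_ : 4 * C ^+ 2 / N * _ =
  4 / N * (C ^+ 2 * (expR (- ((l / 2) ^+ 2 / 2)) * expR (- ((Q / 2) ^+ 2 / 2))))); last by ring.
apply: ler_wpM2l; first by rewrite divr_ge0// ltW.
have split8 (p : R) : expR (- ((p / 2) ^+ 2 / 2)) = expR (3 / 8 * p ^+ 2) * expR (- (p ^+ 2 / 2)).
  by rewrite -expRD; congr expR; field.
rewrite !split8.
rewrite (_ : C ^+ 2 * _ = (C * expR (3 / 8 * l ^+ 2)) * (C * expR (3 / 8 * Q ^+ 2)) *
  (expR (- (l ^+ 2 / 2)) * expR (- (Q ^+ 2 / 2)))); last by ring.
apply: ler_wpM2r; first by rewrite mulr_ge0.
by apply: ler_pM (hC l) (hC Q); rewrite exprn_ge0// addr_ge0.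
Qed.

Lemma psik_le k y : psik k y <= 2 ^- k.
Proof.
rewrite /psik !normal_funE ?scale_gt0//.
have e1 (p : R) : expR (- (p ^+ 2 / 2)) <= 1.
  by rewrite -[leRHS]expR0 ler_expR oppr_le0 divr_ge0// sqr_ge0.
by rewrite ler_piMr ?invr_ge0 ?exprn_ge0// mulr_ile1.
Qed.

(* With [S] the partial sums, [S_(m+1) ^ 2 <= S_m ^ 2 + 2 psik m S_(m+1)]: only pairs
   [l <= m] contribute, and they sum geometrically. *)
Lemma weight_sum j y : (j <= n.+1)%N ->
  V y * (\sum_(k < j) psik k y) ^+ 2 <=
  \sum_(m < j) 2 * 2 ^- m * \sum_(l < m.+1) 4 * C ^+ 2 / N * wide l y.
Proof.
elim: j => [_|j IH jn]; first by rewrite !big_ord0 expr0n mulr0.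
rewrite big_ord_recr [leRHS]big_ord_recr /=.
have := IH (ltnW jn).
have hV : V y * (\sum_(k < j.+1) psik k y) <= \sum_(l < j.+1) 4 * C ^+ 2 / N * wide l y.
  rewrite mulr_sumr; apply: ler_sum => k _; apply: weight_psik.
  by rewrite -ltnS (leq_trans (ltn_ord k)).
move: hV; rewrite [in X in X -> _]big_ord_recr /=.
have p0 := psik_gt0 j y; have p1 := psik_le j y; have V0 := weight_ge0 y.
have S0 : 0 <= \sum_(k < j) psik k y by apply: sumr_ge0 => k _; exact/ltW/psik_gt0.
move: p0 p1 V0 S0; set W := V y; set S := \sum_(k < j) _; set p := psik j y.
set A := \sum_(m < j) _; set B := \sum_(l < j.+1) _; set e := 2 ^- j.
move=> p0 p1 V0 S0 hB hA.
have B0 : 0 <= B by apply: le_trans hB; rewrite mulr_ge0// addr_ge0// ltW.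
have h1 : p * (W * (S + p)) <= e * B.
  by apply: ler_pM => //; [exact: ltW|rewrite mulr_ge0// addr_ge0// ltW].
have h2 : 0 <= W * p ^+ 2 by apply: mulr_ge0 => //; exact: sqr_ge0.
rewrite (_ : W * (S + p) ^+ 2 = W * S ^+ 2 + 2 * (p * (W * (S + p))) - W * p ^+ 2); last by ring.
lra.
Qed.

(** The term of [wide l] integrates to 16 C^2 q^2 2^l / N^2. The sum over l <= m is at most 2^(m+1)
    times the constant and meets the factor 2 2^-m, so that every m contributes 64 C^2 q^2 / N^2. *)
Lemma psi_weight :
  (\int[leb2 R]_y ((1 + 4 * `|y.1 - omega y.2|) * (1 + `|y.2|)^-1 * psi y ^+ 2)%:E <=
   (64 * C ^+ 2 * q ^+ 2 * n.+1%:R / N ^+ 2)%:E)%E.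
Proof.
have b2 : 0 < 2 :> R by [].
have iw l : integral_is (fun y => 4 * C ^+ 2 / N * wide l y)
    (4 * C ^+ 2 / N * ((normal_peak 2)^-1 * (normal_peak (2 * scale l))^-1)).
  by apply: integral_isZ; apply: integral_is_tensor => //; rewrite mulr_gt0// scale_gt0.
have is1 m := integral_isZ (2 * 2 ^- m) _ _ (integral_is_sum m.+1 _ _ (fun l _ => iw l)).
have is2 := integral_is_sum n.+1 _ _ (fun m _ => is1 m).
apply: le_trans.
  apply: (integral_is_le _ _ _ _ _ is2) => y.
    by apply: mulr_ge0; [exact: weight_ge0|exact: sqr_ge0].
  exact: weight_sum.
rewrite lee_fin.
apply: (@le_trans _ _ (\sum_(m < n.+1) 64 * C ^+ 2 * q ^+ 2 / N ^+ 2)); last first.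
  by rewrite sumr_const card_ord -mulr_natr le_eqVlt; apply/orP; left; apply/eqP; ring.
apply: ler_sum => m _.
have -> : \sum_(l < m.+1) 4 * C ^+ 2 / N * ((normal_peak 2)^-1 * (normal_peak (2 * scale l))^-1) =
    16 * C ^+ 2 * q ^+ 2 / N ^+ 2 * \sum_(l < m.+1) 2 ^+ l.
  rewrite mulr_sumr; apply: eq_bigr => l _.
  rewrite (normal_peakV 2)// (normal_peakV (2 * scale l)) ?mulr_gt0 ?scale_gt0//.
  by set p := q; rewrite /scale; field; rewrite gt_eqF.
have geo j : \sum_(l < j) 2 ^+ l <= 2 ^+ j :> R.
  elim: j => [|j IH]; first by rewrite big_ord0.
  by rewrite big_ord_recr/= exprS mulr2n mulrDl !mul1r lerD2r.
have c0 : 0 <= 16 * C ^+ 2 * q ^+ 2 / N ^+ 2.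
  by rewrite divr_ge0 ?exprn_ge0 ?(ltW N0)// mulr_ge0 ?sqr_ge0// mulr_ge0 ?sqr_ge0.
apply: (@le_trans _ _ (2 * 2 ^- m * (16 * C ^+ 2 * q ^+ 2 / N ^+ 2 * 2 ^+ m.+1))).
  by apply: ler_wpM2l; [rewrite mulr_ge0// invr_ge0 exprn_ge0|rewrite ler_wpM2l].
rewrite le_eqVlt; apply/orP; left; apply/eqP; rewrite [2 ^+ m.+1]exprS.
by set p := q; field; rewrite gt_eqF//= expf_neq0.
Qed.

End test_function.

(** * Growth of the left-hand side and the contradiction *)

Lemma Xnorm_test_lower {R : realType} (chi0 chi : R -> R) :
  is_chi0 chi0 -> is_chi chi -> exists2 c : R, 0 < c & forall n : nat,
  ((c * (2 ^+ n * Num.sqrt n.+1%:R))%:E <= Xnorm chi0 chi (- (1 / 2)) (1 / 2)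
    (dist_dx (dist_of (fun z => (packet 0 1 z * packet (2 ^+ n) (2 ^+ n) z)%R))))%E.
Proof.
move=> hchi0 hchi.
have [C C0 hC] := @one_plus_abs_expR R 3 (3 / 8) ltac:(lra).
set q := (normal_peak (1 : R))^-1.
have q0 : 0 < q by rewrite invr_gt0 normal_peak_gt0.
(* The constant of the pairing over the root of that in [psi_weight]; the powers of n + 1 leave a
   square root. *)
exists (q ^+ 4 / 4 / (8 * C * q)); first by rewrite divr_gt0 ?mulr_gt0 ?exprn_gt0.
move=> n; have N0 : 0 < 2 ^+ n :> R by exact: exprn_gt0.
have k0 : 0 < 64 * C ^+ 2 * q ^+ 2 * n.+1%:R / (2 ^+ n) ^+ 2.
  by rewrite divr_gt0 ?exprn_gt0// mulr_gt0// mulr_gt0 ?exprn_gt0// mulr_gt0 ?exprn_gt0.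
have h := Im_dist_le_Xnorm chi0 chi hchi0 hchi (phi n) (psi n) _ (schwartz_phi n)
  (psi_gt0 n) (psi_integrable n) (Re_phi_psi n) (Im_phi_psi n) k0 (psi_weight n C hC)
  (dist_dx (dist_of (fun z => packet 0 1 z * packet (2 ^+ n) (2 ^+ n) z))).
apply: le_trans h.
rewrite lee_fin.
have sn0 : 0 < Num.sqrt n.+1%:R :> R by rewrite sqrtr_gt0.
have -> : Num.sqrt (64 * C ^+ 2 * q ^+ 2 * n.+1%:R / (2 ^+ n) ^+ 2) =
    8 * C * q * Num.sqrt n.+1%:R / 2 ^+ n.
  rewrite (_ : _ / _ = (8 * C * q / 2 ^+ n) ^+ 2 * n.+1%:R); last by field; rewrite gt_eqF.
  rewrite sqrtrM ?sqr_ge0// sqrtr_sqr ger0_norm; first by ring.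
  by rewrite divr_ge0 ?(ltW N0)// mulr_ge0 ?(ltW q0)// mulr_ge0// ltW.
apply: le_trans (ler_wpM2r _ (Im_test_lower n)); last first.
  by rewrite invr_ge0 divr_ge0 ?(ltW N0)// mulr_ge0 ?(ltW sn0)// mulr_ge0 ?(ltW q0)// mulr_ge0// ltW.
have er : n.+1%:R = Num.sqrt n.+1%:R ^+ 2 :> R by rewrite sqr_sqrtr ?ler0n.
rewrite -/q; move: N0 sn0 er; set N : R := 2 ^+ n; set r := Num.sqrt _ => N0 sn0 ->.
by rewrite le_eqVlt; apply/orP; left; apply/eqP; field; rewrite !gt_eqF.
Qed.

Theorem proposition3p4 (R : realType) (chi0 chi : R -> R)
    (hchi0 : is_chi0 chi0) (hchi : is_chi chi) :
  let Xn := fun u : R * R -> R[i] =>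
    Xnorm chi0 chi (1 / 2) (1 / 2) (dist_of u) in
  let Yn := fun u : R * R -> R[i] =>
    Ynorm chi0 chi (1 / 2) (- (1 / 2)) (1 / 2) (dist_of u) in
  ~ exists C : R, forall u1 u2 : R * R -> R[i],
    tempered_fun u1 -> tempered_fun u2 ->
    (X chi0 chi (1 / 2) (1 / 2) `&` Y chi0 chi (1 / 2) (- (1 / 2)) (1 / 2))
      (dist_of u1) ->
    (X chi0 chi (1 / 2) (1 / 2) `&` Y chi0 chi (1 / 2) (- (1 / 2)) (1 / 2))
      (dist_of u2) ->
    (Xnorm chi0 chi (- (1 / 2)) (1 / 2)
       (dist_dx (dist_of (fun z => (u1 z * u2 z)%R)))
     <= C%:E * Xn u1 *
          (Xn u2 + sqrte (Xn u2) * sqrte (Yn u2))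
      + C%:E * Xn u2 *
          (Xn u1 + sqrte (Xn u1) * sqrte (Yn u1)))%E.
Proof.
move=> Xn Yn [C hC].
have [K K0 hK] := schwartz_Xnorm_packet chi0 chi hchi0 hchi.
have [c c0 hc] := Xnorm_test_lower chi0 chi hchi0 hchi.
have XY (nu a : R) : 0 < a ->
    (X chi0 chi (1 / 2) (1 / 2) `&` Y chi0 chi (1 / 2) (- (1 / 2)) (1 / 2))
      (dist_of (packet nu a)).
  move=> a0; split; first by exists (fun=> packet nu a); exact/X_approx_cst/schwartz_packet.
  split; [rewrite dist_mulxE|rewrite dist_multE];
    [exists (fun=> (fun z => (z.1)%:C * packet nu a z))|exists (fun=> (fun z => (z.2)%:C * packet nu a z))];
    apply: X_approx_cst; [exact: schwartz_packet_x|exact: schwartz_packet_t].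
(* The norms are replaced by real numbers, so that the estimate becomes an inequality between
   reals. *)
have Xn_le (nu a : R) : 0 <= nu -> nu <= a -> 1 <= a -> a <= 1 + nu ->
    exists2 x : R, 0 <= x <= K * a & Xn (packet nu a) = x%:E.
  move=> nu0 nua a1 anu; have [h _ _] := hK nu a nu0 nua a1 anu.
  have a0 : 0 < a by exact: lt_le_trans a1.
  have := le_trans (Xnorm_le_schwartz chi0 chi _ _ _ (schwartz_packet nu a a0)) h.
  have := Xnorm_ge0 chi0 chi (1 / 2) (1 / 2) (dist_of (packet nu a)); rewrite /Xn.
  by case: (Xnorm _ _ _ _ _) => [x||]//=; rewrite !lee_fin => x0 x1; exists x => //; rewrite x0.
(* Two terms would give 2 K a; the factor 4 is chosen for its exact square root. *)
have Yn_le (nu a : R) : 0 <= nu -> nu <= a -> 1 <= a -> a <= 1 + nu ->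
    exists2 x : R, 0 <= x <= 4 * (K * a) & Yn (packet nu a) = x%:E.
  move=> nu0 nua a1 anu; have [_ h1 h2] := hK nu a nu0 nua a1 anu.
  have a0 : 0 < a by exact: lt_le_trans a1.
  have Ka : 0 <= K * a by rewrite mulr_ge0 ?ltW.
  have := le_trans (Xnorm_le_schwartz chi0 chi _ _ _ (schwartz_packet_x nu a a0)) h1.
  have := le_trans (Xnorm_le_schwartz chi0 chi _ _ _ (schwartz_packet_t nu a a0)) h2.
  rewrite -dist_mulxE -dist_multE.
  have := Xnorm_ge0 chi0 chi (1 / 2) (- (1 / 2)) (dist_mulx (dist_of (packet nu a))).
  have := Xnorm_ge0 chi0 chi (1 / 2) (1 / 2) (dist_mult (dist_of (packet nu a))).
  rewrite /Yn /Ynorm.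
  case: (Xnorm _ _ _ _ _) => [x||]//; case: (Xnorm _ _ _ _ _) => [y||]//.
  rewrite !lee_fin => y0 x0 y1 x1; exists (y + x) => //.
  by rewrite addr_ge0//=; lra.
have sqrt_le (x y A : R) : 0 <= x <= A -> 0 <= y <= 4 * A -> Num.sqrt x * Num.sqrt y <= 2 * A.
  move=> /andP[x0 xA] /andP[y0 yA]; have A0 := le_trans x0 xA.
  have -> : 2 * A = Num.sqrt A * Num.sqrt (4 * A).
    rewrite -sqrtrM// (_ : A * (4 * A) = (2 * A) ^+ 2); last by ring.
    by rewrite sqrtr_sqr ger0_norm// mulr_ge0.
  by apply: ler_pM; rewrite ?sqrtr_ge0// ler_wsqrtr.
(* Each of the two terms on the right is at most 3 K^2 N in absolute value, up to |C|, and N cancels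
   against that of the lower bound. *)
have bound (n : nat) : c * Num.sqrt n.+1%:R <= 6 * `|C| * K ^+ 2.
  set N : R := 2 ^+ n; have N1 : 1 <= N by rewrite exprn_ege1// ler1n.
  have N0 : 0 < N by exact: lt_le_trans N1.
  have N1' : N <= 1 + N by rewrite lerDr.
  have z01 : 1 <= 1 + 0 :> R by rewrite addr0.
  have [x1 hx1 Ex1] := Xn_le 0 1 (lexx 0) ler01 (lexx 1) z01.
  have [y1 hy1 Ey1] := Yn_le 0 1 (lexx 0) ler01 (lexx 1) z01.
  have [x2 hx2 Ex2] := Xn_le N N (ltW N0) (lexx N) N1 N1'.
  have [y2 hy2 Ey2] := Yn_le N N (ltW N0) (lexx N) N1 N1'.
  have s1 := sqrt_le _ _ _ hx1 hy1; have s2 := sqrt_le _ _ _ hx2 hy2.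
  have := hC _ _ (schwartz_tempered _ (schwartz_packet 0 1 ltr01))
    (schwartz_tempered _ (schwartz_packet N N N0)) (XY 0 1 ltr01) (XY N N N0).
  rewrite Ex1 Ey1 Ex2 Ey2 => hR.
  have : ((c * (N * Num.sqrt n.+1%:R))%:E <= (C * x1 * (x2 + Num.sqrt x2 * Num.sqrt y2) +
     C * x2 * (x1 + Num.sqrt x1 * Num.sqrt y1))%:E)%E := le_trans (hc n) hR.
  rewrite lee_fin.
  move: s1 s2 hx1 hx2; set t1 := Num.sqrt x1 * _; set t2 := Num.sqrt x2 * _.
  have t10 : 0 <= t1 by rewrite mulr_ge0 ?sqrtr_ge0.
  have t20 : 0 <= t2 by rewrite mulr_ge0 ?sqrtr_ge0.
  rewrite mulr1 => s1 s2 /andP[x10 x1K] /andP[x20 x2K] h.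
  rewrite -(ler_pM2r N0); apply: (@le_trans _ _ (c * (N * Num.sqrt n.+1%:R))).
    by rewrite mulrAC mulrA.
  apply: (le_trans h).
  have cC : C <= `|C| by exact: ler_norm.
  have m1 : x1 * (x2 + t2) <= K * (3 * (K * N)).
    by apply: ler_pM => //; [exact: addr_ge0|lra].
  have m2 : x2 * (x1 + t1) <= K * N * (3 * K).
    by apply: ler_pM => //; [exact: addr_ge0|lra].
  have m3 : 0 <= x1 * (x2 + t2) by rewrite mulr_ge0// addr_ge0.
  have m4 : 0 <= x2 * (x1 + t1) by rewrite mulr_ge0// addr_ge0.
  rewrite -!mulrA -mulrDr.
  apply: (@le_trans _ _ (`|C| * (x1 * (x2 + t2) + x2 * (x1 + t1)))).
    by apply: ler_wpM2r => //; exact: addr_ge0.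
  rewrite (_ : 6 * _ = `|C| * (6 * (K ^+ 2 * N))); last by ring.
  by apply: ler_wpM2l => //; lra.
pose B := 6 * `|C| * K ^+ 2 / c.
have [n hn] : exists n : nat, B ^+ 2 < n%:R.
  by exists (Num.bound (B ^+ 2)); rewrite archi_boundP// sqr_ge0.
have := bound n; rewrite mulrC -ler_pdivlMr// -/B => hB.
have B0 : 0 <= B by apply: le_trans hB; exact: sqrtr_ge0.
have : n.+1%:R <= B ^+ 2.
  by rewrite -[leLHS](@sqr_sqrtr R) ?ler0n// lerXn2r// nnegrE ?sqrtr_ge0.
by rewrite leNgt (lt_le_trans hn)// ler_nat.
Qed.
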